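(* Let $F$ be the distribution function of a real random variable $Z$, let $Z_1,Z_2$ be i.i.d. copies of $Z$, and suppose that $h_F$ exists and is square integrable. Then there exists a complete system of orthonormal functions $\{g_k\}$ of $L_2(F)$ consisting of eigenfunctions of $h_F$, the corresponding eigenvalues $\{\lambda_k\}$ being nonnegative. Each $g_k$ is continuous and satisfies $Eg_k(Z)=0$ if $\lambda_k\neq0$. Furthermore, $h_F$ has the spectral decomposition $$h_F(Z_1,Z_2)=\sum_{k=1}^\infty\lambda_kg_k(Z_1)g_k(Z_2),$$ where convergence is in mean square.
   Context: The distribution function is taken in the convention $F(z)=P(Z<z)+\tfrac12P(Z=z)$; no restriction is placed on the distribution. Define $$h_F(z_1,z_2)=-\tfrac12E\big(|z_1-z_2|-|z_1-Z_2|-|Z_1-z_2|+|Z_1-Z_2|\big).$$ $h_F$ exists if this expectation is finite for some $(z_1,z_2)\in\mathbb R^2$ (then for all), and it is square integrable if $Eh_F(Z_1,Z_2)^2<\infty$. $L_2(F)$ is the set of functions $g:\mathbb R\to\mathbb R$ with $\int g^2dF<\infty$. A system $\{g_k\}$ is orthonormal if $Eg_k(Z)g_l(Z)=\delta_{kl}$, and complete if every $g\in L_2(F)$ can be written as $g(Z)=\sum_k\alpha_kg_k(Z)$ with real $\alpha_k$ and convergence in mean square, i.e. in the sense that $E(W-W^{(N)})^2\to0$ for the partial sums $W^{(N)}$. A number $\lambda$ is an eigenvalue of $h_F$ with corresponding eigenfunction $g$ if $Eg(Z)^2=1$ and $\lambda g(z)=Eh_F(z,Z)g(Z)$. (If $L_2(F)$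 is finite-dimensional, the system and the sums are finite.) *)

(* Defs.v *)
From HB Require Import structures.
From mathcomp Require Import all_boot all_order all_algebra.
From mathcomp Require Import all_classical all_reals all_analysis.

Set Implicit Arguments.
Unset Strict Implicit.
Unset Printing Implicit Defensive.

Import Order.TTheory GRing.Theory Num.Theory.
Import numFieldNormedType.Exports.

Local Open Scope classical_set_scope.
Local Open Scope ereal_scope.
Local Open Scope ring_scope.

Section Defs.
Context {d : measure_display} {T : measurableType d} {R : realType}.
Variable P : probability T R.

Definition is_distribution_function (X : {RV P >-> R}) (F : R -> R) : Prop :=
  forall z, (F z)%:E =
    (P [set w | (X w < z)%R] + (2^-1)%:E * P [set w | X w = z])%E.

Definition identically_distributed (X Y : {RV P >-> R}) : Prop :=
  forall A : set R, measurable A -> distribution P X A = distribution P Y A.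

Definition independent_rv (X Y : {RV P >-> R}) : Prop :=
  forall A B : set R, measurable A -> measurable B ->
    P (X @^-1` A `&` Y @^-1` B) = (P (X @^-1` A) * P (Y @^-1` B))%E.

Definition iid_copies (Z Z1 Z2 : {RV P >-> R}) : Prop :=
  [/\ identically_distributed Z1 Z, identically_distributed Z2 Z
    & independent_rv Z1 Z2].

Definition kernel_integrand (Z1 Z2 : {RV P >-> R}) (z1 z2 : R) (w : T) : R :=
  `|z1 - z2| - `|z1 - Z2 w| - `|Z1 w - z2| + `|Z1 w - Z2 w|.

(* Only the sum of the four terms need be integrable: Z may have no mean. *)
Definition kernel_exists (Z1 Z2 : {RV P >-> R}) : Prop :=
  exists z1 z2 : R,
    P.-integrable setT (EFin \o kernel_integrand Z1 Z2 z1 z2).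

Definition h_kernel (Z1 Z2 : {RV P >-> R}) (z1 z2 : R) : R :=
  - 2^-1 * fine 'E_P[kernel_integrand Z1 Z2 z1 z2].

Definition square_integrable_kernel (h : R -> R -> R)
    (Z1 Z2 : {RV P >-> R}) : Prop :=
  ('E_P[fun w => (h (Z1 w) (Z2 w) ^+ 2)%R] < +oo)%E.

(* L_2(F) is a set of functions, not of classes modulo a.e. equality. *)
Definition L2 (Z : {RV P >-> R}) : {pred R -> R} :=
  Lfun (distribution P Z) 2%:E.

Definition mean_square_cvg (W_ : nat -> T -> R) (W : T -> R) : Prop :=
  'E_P[fun w => (W w - W_ N w) ^+ 2] @[N --> \oo] --> 0%E.

(* A system (g k) is indexed by all k : nat if m = None, and by the k < n if
   m = Some n; for m = Some n, [psum] is the whole finite sum once N >= n. *)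
Definition in_system (m : option nat) (k : nat) : bool :=
  if m is Some n then (k < n)%N else true.

Definition psum (m : option nat) (u : nat -> T -> R) (N : nat) (w : T) : R :=
  \sum_(0 <= k < N | in_system m k) u k w.

Definition orthonormal_system (Z : {RV P >-> R}) (m : option nat)
    (g : nat -> R -> R) : Prop :=
  (forall k, in_system m k -> g k \in L2 Z) /\
  (forall k l, in_system m k -> in_system m l ->
     'E_P[fun w => g k (Z w) * g l (Z w)] = ((k == l)%:R)%:E).

Definition complete_system (Z : {RV P >-> R}) (m : option nat)
    (g : nat -> R -> R) : Prop :=
  forall f, f \in L2 Z -> exists a : nat -> R,
    mean_square_cvg (psum m (fun k w => a k * g k (Z w))) (f \o Z).

(* The eigenfunction equation is required at every real z, not just a.e. *)
Definition is_eigenfunction (h : R -> R -> R) (Z : {RV P >-> R})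
    (lam : R) (g : R -> R) : Prop :=
  'E_P[fun w => g (Z w) ^+ 2] = 1%E /\
  (forall z, (lam * g z)%:E = 'E_P[fun w => h z (Z w) * g (Z w)]).

End Defs.

(* Main.v *)
Require Import Defs.
From HB Require Import structures.
From mathcomp Require Import all_boot all_order all_algebra.
From mathcomp Require Import all_classical all_reals all_analysis.
From mathcomp Require Import measurable_realfun ring lra.
(** Let F(t) = P(Z <= t) and phi(x,t) = 1{x <= t} - F(t). Since |x - y| is the
    integral over t of (1{x <= t} - 1{y <= t})^2, the terms of h_F that depend on
    one variable only cancel and h_F(x,y) is the integral of phi(x,t) phi(y,t)
    [h_kernelE]. This formula makes h_F Lipschitz in each variable
    [energy_kernel_Lipschitz] and, as E phi(Z,t) = 0, gives E h_F(x,Z) = 0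
    [integral_energy_kernel].

    Let K be the integral operator of h_F on L_2(F). The integral over t of
    (E phi(Z,t) f(Z))^2 is at most <Kf,f> [energy_inequality]. So K is positive,
    and <Kf,f> = 0 forces the covariance of f(Z) with every 1{Z <= t} to vanish,
    hence f to be almost surely constant [energy_form_definite]. The null space
    of K thus consists of the constants: the constant 1 is a continuous
    eigenfunction for the eigenvalue 0, and every other eigenfunction is
    g = Kg / lam with lam > 0, a Lipschitz function orthogonal to 1.

    The spectral theorem is proved for a positive operator K that maps bounded
    weakly null sequences to sequences converging to 0, which a square integrable
    kernel does by dominated convergence. A largest eigenvalue is found without
    extracting subsequences: if A is K divided by its norm, the even iterates
    A^(2n) f converge for every f by monotonicity of |A^n f|, and their limits
    yield vectors fixed by A; were these all null, a maximizing sequence for |A f|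
    would be weakly null, against the choice of A [contraction_fixed_vector].
    Eigenvectors are then chosen one after the other, each with the largest
    eigenvalue on the orthogonal complement of the previous ones
    [exists_greedy_family]. The eigenvalues tend to 0, so the limit of the
    residuals of any f lies in the null space of K and is orthogonal to its
    spanning vector, and the system is complete [compact_spectral_theorem].

    Finally h_F(x,.) has the coefficients lam_k g_k(x) for every x, by the
    eigenfunction equation. Its expansion therefore converges in L_2(F) for every
    x, with errors dominated by the square integrable function |h_F(x,.)|, and
    integration over x gives the expansion of the kernel [kernel_expansion]. *)

Set Implicit Arguments.
Unset Strict Implicit.
Unset Printing Implicit Defensive.

Import Order.TTheory GRing.Theory Num.Theory.
Import numFieldNormedType.Exports.
Local Open Scope classical_set_scope.
Local Open Scope ereal_scope.
Local Open Scope ring_scope.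

(** * Spaces with a positive semidefinite form *)

Section SemiInnerProduct.
Context {R : realType} {V : lmodType R}.

(** Definiteness is not required: elements of L_2 are kept as functions instead
    of classes modulo almost everywhere equality, and may be null. *)
Definition semi_inner (B : V -> V -> R) : Prop :=
  [/\ forall u v, B u v = B v u,
      forall a u v w, B (a *: u + v) w = a * B u w + B v w
    & forall u, 0 <= B u u].

Variable B : V -> V -> R.
Hypothesis HB : semi_inner B.

Definition nrm (u : V) : R := Num.sqrt (B u u).

Definition norm_cvg (u : nat -> V) (l : V) : Prop :=
  nrm (u n - l) @[n --> \oo] --> (0 : R).

Definition norm_complete : Prop := forall u : nat -> V,
  (forall e : R, 0 < e ->
     exists n0, forall m n, (n0 <= m)%N -> (n0 <= n)%N -> nrm (u m - u n) < e) ->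
  exists l, norm_cvg u l.

Definition weakly_null (u : nat -> V) : Prop :=
  forall v, B (u n) v @[n --> \oo] --> (0 : R).

(** Compactness, in the form that follows for integral operators from dominated
    convergence. *)
Definition completely_continuous (A : V -> V) : Prop :=
  forall u : nat -> V, (forall n, nrm (u n) <= 1) -> weakly_null u ->
  nrm (A (u n)) @[n --> \oo] --> (0 : R).

Lemma innerC u v : B u v = B v u. Proof. by case: HB. Qed.
Lemma inner_ge0 u : 0 <= B u u. Proof. by case: HB. Qed.
Lemma innerP a u v w : B (a *: u + v) w = a * B u w + B v w.
Proof. by case: HB. Qed.
Lemma innerDl u v w : B (u + v) w = B u w + B v w.
Proof. by have := innerP 1 u v w; rewrite scale1r mul1r. Qed.
Lemma inner0l w : B 0 w = 0.
Proof. by have := innerDl 0 0 w; rewrite addr0; lra. Qed.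
Lemma innerZl a u w : B (a *: u) w = a * B u w.
Proof. by rewrite -[a *: u]addr0 innerP inner0l addr0. Qed.
Lemma innerNl u w : B (- u) w = - B u w.
Proof. by rewrite -scaleN1r innerZl mulN1r. Qed.
Lemma innerBl u v w : B (u - v) w = B u w - B v w.
Proof. by rewrite innerDl innerNl. Qed.
Lemma innerDr u v w : B w (u + v) = B w u + B w v.
Proof. by rewrite innerC innerDl !(innerC w). Qed.
Lemma inner0r w : B w 0 = 0. Proof. by rewrite innerC inner0l. Qed.
Lemma innerZr a u w : B w (a *: u) = a * B w u.
Proof. by rewrite innerC innerZl (innerC w). Qed.
Lemma innerBr u v w : B w (u - v) = B w u - B w v.
Proof. by rewrite innerC innerBl !(innerC w). Qed.
Lemma inner_suml I (s : seq I) (P : pred I) (F : I -> V) w :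
  B (\sum_(i <- s | P i) F i) w = \sum_(i <- s | P i) B (F i) w.
Proof.
by apply: (big_morph (fun u => B u w)) => [u v|]; rewrite ?innerDl ?inner0l.
Qed.

Lemma nrm_ge0 u : 0 <= nrm u. Proof. exact: sqrtr_ge0. Qed.
Lemma nrm_sqr u : nrm u ^+ 2 = B u u.
Proof. by rewrite sqr_sqrtr// inner_ge0. Qed.

Lemma innerDD u v : B (u + v) (u + v) = B u u + 2 * B u v + B v v.
Proof. by rewrite innerDl !innerDr (innerC v u); ring. Qed.
Lemma innerBB u v : B (u - v) (u - v) = B u u - 2 * B u v + B v v.
Proof. by rewrite innerBl !innerBr (innerC v u); ring. Qed.

(** The usual discriminant argument needs a second case, as v may be null. *)
Lemma inner_le_sqr u v : B u v ^+ 2 <= B u u * B v v.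
Proof.
have Q t : 0 <= B u u - 2 * t * B u v + t ^+ 2 * B v v.
  have := inner_ge0 (u - t *: v).
  by rewrite innerBB innerZr innerZl innerZr; lra.
have [v0|v0] := eqVneq (B v v) 0; last first.
  have vp : 0 < B v v by rewrite lt_neqAle eq_sym v0 inner_ge0.
  have := Q (B u v / B v v).
  have -> : B u u - 2 * (B u v / B v v) * B u v + (B u v / B v v) ^+ 2 * B v v
     = (B u u * B v v - B u v ^+ 2) / B v v by field.
  by rewrite pmulr_lge0 ?invr_gt0// subr_ge0.
have [->|uv0] := eqVneq (B u v) 0; first by rewrite expr0n/= v0 mulr0.
(* As B v v = 0, the quadratic Q is affine in t; this t gives it the value -1. *)
have := Q ((B u u + 1) / (2 * B u v)); rewrite v0.
have -> : B u u - 2 * ((B u u + 1) / (2 * B u v)) * B u v +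
  ((B u u + 1) / (2 * B u v)) ^+ 2 * 0 = - 1 by field.
lra.
Qed.

Lemma inner_le_nrmM u v : `|B u v| <= nrm u * nrm v.
Proof.
rewrite -ler_sqr ?nnegrE ?mulr_ge0 ?nrm_ge0//.
by rewrite exprMn !nrm_sqr real_normK ?num_real// inner_le_sqr.
Qed.

Lemma nrmD u v : nrm (u + v) <= nrm u + nrm v.
Proof.
rewrite -ler_sqr ?nnegrE ?addr_ge0 ?nrm_ge0//.
rewrite nrm_sqr innerDD sqrrD !nrm_sqr.
have := inner_le_nrmM u v; have := ler_norm (B u v); lra.
Qed.

Lemma nrmZ a u : nrm (a *: u) = `|a| * nrm u.
Proof.
by rewrite /nrm innerZl innerZr mulrA -expr2 sqrtrM ?sqr_ge0// sqrtr_sqr.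
Qed.
Lemma nrmN u : nrm (- u) = nrm u.
Proof. by rewrite -scaleN1r nrmZ normrN1 mul1r. Qed.
Lemma nrmBC u v : nrm (u - v) = nrm (v - u).
Proof. by rewrite -nrmN opprB. Qed.

Lemma nrm_eq0_innerl u v : nrm u = 0 -> B u v = 0.
Proof.
move=> u0; have := inner_le_nrmM u v; rewrite u0 mul0r normr_le0.
by move/eqP.
Qed.

Lemma cvg0_le (a b : nat -> R) : (forall n, 0 <= a n <= b n) ->
  b n @[n --> \oo] --> (0 : R) -> a n @[n --> \oo] --> (0 : R).
Proof.
move=> ab b0; apply: (@squeeze_cvgr _ _ _ _ (fun=> 0) b) => //; last exact: cvg_cst.
by near=> n; exact: ab.
Unshelve. all: by end_near. Qed.

Lemma le0_cvg0 (x : R) (b : nat -> R) : (forall n, x <= b n) ->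
  b n @[n --> \oo] --> (0 : R) -> x <= 0.
Proof.
move=> xb b0; rewrite -(cvg_lim (@Rhausdorff R) b0).
apply: limr_ge; first by apply/cvg_ex; exists 0.
by near=> n; exact: xb.
Unshelve. all: by end_near. Qed.

Lemma cvg0_sqr (w : nat -> R) :
  w n ^+ 2 @[n --> \oo] --> (0 : R) -> w n @[n --> \oo] --> (0 : R).
Proof.
move=> w2; apply/norm_cvg0P.
under eq_fun do rewrite -sqrtr_sqr.
rewrite -(sqrtr0 R); apply: (continuous_cvg _ _ w2).
exact: sqrt_continuous.
Qed.

Lemma norm_cvg_innerl0 (u : nat -> V) l v : norm_cvg u l ->
  (forall n, B (u n) v = 0) -> B l v = 0.
Proof.
move=> ul uv; apply/eqP; rewrite -normr_le0.
have cv : nrm (u n - l) * nrm v @[n --> \oo] --> (0 : R).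
  by rewrite -(mul0r (nrm v)); apply: cvgM => //; exact: cvg_cst.
apply: le0_cvg0 cv => n.
have -> : B l v = B (l - u n) v by rewrite innerBl uv subr0.
by rewrite nrmBC inner_le_nrmM.
Qed.

Lemma quadratic_form_cvg (A : {linear V -> V}) C (u : nat -> V) l :
  (forall v, nrm (A v) <= C * nrm v) -> norm_cvg u l ->
  B (A (u n)) (u n) @[n --> \oo] --> B (A l) l.
Proof.
move=> AC ul.
pose b n := C * nrm (u n - l) * nrm (u n - l) + C * nrm (u n - l) * nrm l +
  C * nrm l * nrm (u n - l).
have b0 : b n @[n --> \oo] --> (0 : R).
  rewrite (_ : 0 = C * 0 * 0 + C * 0 * nrm l + C * nrm l * 0); last by ring.
  have Cd : C * nrm (u n - l) @[n --> \oo] --> C * 0 by apply: cvgMl_tmp.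
  apply: cvgD; last exact: cvgMl_tmp.
  by apply: cvgD; [exact: cvgM|exact: cvgMr_tmp].
have key : B (A (u n)) (u n) - B (A l) l @[n --> \oo] --> (0 : R).
  apply/norm_cvg0P; apply: cvg0_le b0 => n; rewrite normr_ge0/=.
  have -> : B (A (u n)) (u n) - B (A l) l = B (A (u n - l)) (u n - l) +
      B (A (u n - l)) l + B (A l) (u n - l).
    by rewrite !linearB/= !(innerBl, innerBr); ring.
  apply: le_trans (ler_normD _ _) _; apply: lerD; last first.
    by apply: le_trans (inner_le_nrmM _ _) _; rewrite ler_wpM2r ?nrm_ge0.
  apply: le_trans (ler_normD _ _) _; apply: lerD;
    by apply: le_trans (inner_le_nrmM _ _) _; rewrite ler_wpM2r ?nrm_ge0.
exact/subr_cvg0.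
Qed.

End SemiInnerProduct.

(** * Fixed vectors of compact contractions *)

Section FixedVector.
Context {R : realType} {V : lmodType R} (B : V -> V -> R).
Hypotheses (HB : semi_inner B) (Bcomplete : norm_complete B).
(** M plays the role of the orthogonal complement of finitely many eigenvectors
    of A, and Mproj that of the orthogonal projection onto it. *)
Variables (A : {linear V -> V}) (M : V -> Prop).
Local Notation nrm := (nrm B).
Hypotheses (Asym : forall u v, B (A u) v = B u (A v))
  (Apsd : forall u, 0 <= B (A u) u) (Acc : completely_continuous B A).
Hypotheses (MP : forall a u v, M u -> M v -> M (a *: u + v))
  (MA : forall u, M u -> M (A u))
  (Mclosed : forall u l, (forall n, M (u n)) -> norm_cvg B u l -> M l)
  (Mproj : forall v, exists2 w, M w & forall f, M f -> B f v = B f w)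
  (Acontr : forall u, M u -> nrm (A u) <= nrm u).

Let MB u v : M u -> M v -> M (u - v).
Proof. by move=> Mu Mv; rewrite addrC -scaleN1r; exact: MP. Qed.
Let MD u v : M u -> M v -> M (u + v).
Proof. by move=> Mu Mv; rewrite -[u]scale1r; exact: MP. Qed.
Let Miter n u : M u -> M (iter n A u).
Proof. by move=> Mu; elim: n => //= n IH; exact: MA. Qed.

Let sym_iter n u v : B (iter n A u) v = B u (iter n A v).
Proof. by elim: n u v => //= n IH u v; rewrite Asym IH -iterSr. Qed.

Let inner_iter i j k u : (i + j)%N = k.*2 ->
  B (iter i A u) (iter j A u) = nrm (iter k A u) ^+ 2.
Proof. by rewrite nrm_sqr// !sym_iter -!iterD => ->; rewrite addnn. Qed.

(** The numbers |A^n f|^2 decrease, and they determine the mutual distances of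
    the even iterates of f by symmetry of A: hence these iterates converge. *)
Let even_iterates_cvg f : M f ->
  exists l, norm_cvg B (fun n => iter n.*2 A f) l.
Proof.
move=> Mf; pose b n := nrm (iter n A f) ^+ 2.
have b_noninc : nonincreasing_seq b.
  apply/nonincreasing_seqP => n; rewrite /b ler_sqr ?nnegrE ?nrm_ge0//=.
  exact/Acontr/Miter.
have [L bL] : exists L : R, b n @[n --> \oo] --> L.
  exists (lim (b n @[n --> \oo])).
  apply: nonincreasing_is_cvgn => //; exists 0 => _ [n _ <-].
  by rewrite sqr_ge0.
apply: Bcomplete => e e0.
have e4 : 0 < e ^+ 2 / 4 by rewrite divr_gt0 ?exprn_gt0.
have [n0 _ Hn0] := (cvgrPdist_lt _ _).1 bL _ e4.
exists n0 => m n mn0 nn0.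
rewrite -ltr_sqr ?nnegrE ?nrm_ge0 ?ltW// nrm_sqr// innerBB//.
rewrite (@inner_iter _ _ _ f (addnn m.*2)) (@inner_iter _ _ _ f (addnn n.*2)).
rewrite (@inner_iter _ _ _ f (esym (doubleD m n))).
have bd k : (n0 <= k)%N -> `|L - b k| < e ^+ 2 / 4 by exact: Hn0.
have := bd m.*2; have := bd n.*2; have := bd (m + n)%N.
have le2 p q : (n0 <= p)%N -> (n0 <= p + q)%N.
  by move=> /leq_trans; apply; exact: leq_addr.
rewrite -!addnn => /(_ (le2 _ _ mn0)) + /(_ (le2 _ _ nn0)) + /(_ (le2 _ _ mn0)).
rewrite !ltr_norml /b; lra.
Qed.

(** A vector fixed by A^2 only is excluded by positivity: if w = l + A l were
    null, then A l = - l and (A l, l) = - |l|^2. *)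
Let limit_null f l : (forall w, M w -> nrm (A w - w) = 0 -> nrm w = 0) -> M f ->
  norm_cvg B (fun n => iter n.*2 A f) l -> nrm l = 0.
Proof.
move=> nofix Mf fl.
have Ml : M l by apply: Mclosed fl => n; exact: Miter.
have AAl : nrm (A (A l) - l) = 0.
  apply/eqP; rewrite eq_le nrm_ge0 andbT.
  pose a n := nrm (iter n.*2 A f - l).
  have cv : a n + a n.+1 @[n --> \oo] --> (0 : R).
    by rewrite -(addr0 0); apply: cvgD => //; rewrite (cvg_shiftS a).
  apply: le0_cvg0 cv => n.
  have -> : A (A l) - l = A (A (l - iter n.*2 A f)) + (iter n.+1.*2 A f - l).
    by rewrite !linearB/= addrA subrK.
  apply: le_trans (nrmD HB _ _) _; rewrite lerD2r.
  have Mln : M (l - iter n.*2 A f) by apply: MB => //; exact: Miter.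
  apply: le_trans (Acontr (MA Mln)) _; apply: le_trans (Acontr Mln) _.
  by rewrite nrmBC.
have w0 : nrm (l + A l) = 0.
  apply: nofix; first by apply: MD => //; exact: MA.
  by rewrite linearD/= [A l + _]addrC opprD addrACA subrr addr0.
have := nrm_eq0_innerl HB l w0; rewrite innerDl// => Bl.
have l0 : B l l = 0.
  by apply/eqP; rewrite eq_le inner_ge0// andbT; have := Apsd l; lra.
by rewrite /nrm l0 sqrtr0.
Qed.

(** If A has no fixed vector, then every A^2j f tends to 0; since a maximizing
    sequence satisfies |A^2 f_n - f_n| -> 0, it is weakly null, and complete
    continuity contradicts |A f_n| -> 1. *)
Lemma contraction_fixed_vector (f : nat -> V) :
  (forall n, M (f n)) -> (forall n, nrm (f n) <= 1) ->
  nrm (A (f n)) @[n --> \oo] --> (1 : R) ->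
  exists w, [/\ M w, nrm w != 0 & nrm (A w - w) = 0].
Proof.
move=> Mf f1 Af1; apply: contrapT => nofix.
have {}nofix w : M w -> nrm (A w - w) = 0 -> nrm w = 0.
  move=> Mw Aw; apply: contrapT => w0; apply: nofix; exists w; split => //.
  exact/eqP.
have iter0 v : M v -> nrm (iter n.*2 A v) @[n --> \oo] --> (0 : R).
  move=> Mv; have [l vl] := even_iterates_cvg Mv.
  have l0 := limit_null nofix Mv vl.
  apply: cvg0_le vl => n; rewrite nrm_ge0/=.
  rewrite -{1}(subrK l (iter n.*2 A v)).
  by apply: le_trans (nrmD HB _ _) _; rewrite l0 addr0.
pose d n := nrm (A (A (f n)) - f n).
have d0 : d n @[n --> \oo] --> (0 : R).
  have dle n : d n ^+ 2 <= 2 - 2 * nrm (A (f n)) ^+ 2.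
    rewrite /d nrm_sqr// innerBB// (Asym (A (f n)) (f n)) -!nrm_sqr//.
    have := Acontr (MA (Mf n)); have := Acontr (Mf n); have := f1 n.
    move: (nrm_ge0 B (f n)) (nrm_ge0 B (A (f n))) (nrm_ge0 B (A (A (f n)))).
    nra.
  have d20 : d n ^+ 2 @[n --> \oo] --> (0 : R).
    apply: (@cvg0_le _ _ (fun n => 2 - 2 * nrm (A (f n)) ^+ 2)).
      by move=> n; rewrite sqr_ge0 dle.
    rewrite (_ : 0 = 2 - 2 * (1 : R) ^+ 2); last by ring.
    apply: cvgB; first exact: cvg_cst.
    by apply: cvgMr; rewrite expr2; under eq_fun do rewrite expr2; exact: cvgM.
  exact: cvg0_sqr.
(* A^2j - 1 is a sum of j terms A^2i (A^2 - 1), and A does not increase norms on M. *)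
have dj j n : nrm (iter j.*2 A (f n) - f n) <= j%:R * d n.
  elim: j => [|j IH]; first by rewrite /= subrr mul0r /nrm inner0l// sqrtr0.
  have -> : iter j.+1.*2 A (f n) - f n =
     A (A (iter j.*2 A (f n) - f n)) + (A (A (f n)) - f n).
    by rewrite !linearB/= addrA subrK.
  apply: le_trans (nrmD HB _ _) _; rewrite -natr1 mulrDl mul1r lerD2r.
  have Md : M (iter j.*2 A (f n) - f n) by apply: MB => //; exact: Miter.
  by apply: le_trans IH; apply: le_trans (Acontr (MA Md)) _; exact: Acontr.
have fw : weakly_null B f.
  move=> v; have [w Mw vw] := Mproj v.
  apply/cvgr0Pnorm_lt => e e0; have e2 : 0 < e / 2 by rewrite divr_gt0.
  have [j _ /(_ j (leqnn _)) /= jw] := (cvgr0Pnorm_lt _).1 (iter0 _ Mw) _ e2.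
  have cd : j%:R * d n * nrm w @[n --> \oo] --> (0 : R).
    rewrite (_ : 0 = j%:R * (0 : R) * nrm w); last by rewrite mulr0 mul0r.
    by apply: cvgM; [apply: cvgM => //|]; exact: cvg_cst.
  have cd2 := (cvgr0Pnorm_lt _).1 cd _ e2.
  near=> n; have : `|j%:R * d n * nrm w| < e / 2 by near: n; exact: cd2.
  rewrite ger0_norm ?mulr_ge0 ?nrm_ge0// => dn.
  rewrite (vw _ (Mf n)).
  (* Once A^2j w is small, (f_n, w) differs from the small (f_n, A^2j w) by
     ((A^2j - 1) f_n, w), which tends to 0. *)
  have -> : B (f n) w = B (f n) (iter j.*2 A w) - B (iter j.*2 A (f n) - f n) w.
    by rewrite innerBl// sym_iter opprB addrC subrK.
  rewrite (splitr e).
  apply: le_lt_trans (ler_normB _ _) _; apply: ltrD.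
    apply: le_lt_trans (inner_le_nrmM HB _ _) _.
    move: jw; rewrite ger0_norm ?nrm_ge0//.
    apply: le_lt_trans; rewrite ler_piMl ?nrm_ge0//.
  apply: le_lt_trans dn; apply: le_trans (inner_le_nrmM HB _ _) _.
  by rewrite ler_wpM2r ?nrm_ge0.
have := Acc f1 fw => /(cvg_unique (@Rhausdorff R) Af1) /eqP.
by rewrite oner_eq0.
Unshelve. all: by end_near. Qed.

End FixedVector.

(** * Orthonormal systems *)

Section Spectral.
Context {R : realType} {V : lmodType R} (B : V -> V -> R).
Hypotheses (HB : semi_inner B) (Bcomplete : norm_complete B).
Local Notation nrm := (nrm B).

Definition perp (g : nat -> V) n f := forall k, (k < n)%N -> B f (g k) = 0.

Definition residual (g : nat -> V) n f := f - \sum_(0 <= k < n) B f (g k) *: g k.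

(** Zero vectors are allowed so that a system that stops after finitely many
    vectors can be continued by zeros. *)
Definition orthonormal_or_zero (g : nat -> V) n :=
  (forall j k, (j < k < n)%N -> B (g k) (g j) = 0) /\
  (forall k, (k < n)%N -> B (g k) (g k) = 1 \/ g k = 0).

Lemma residualS g n f : residual g n.+1 f = residual g n f - B f (g n) *: g n.
Proof. by rewrite /residual big_nat_recr//= opprD addrA. Qed.

Lemma orthonormal_or_zeroS g n :
  orthonormal_or_zero g n.+1 -> orthonormal_or_zero g n.
Proof.
move=> [go g1]; split=> [j k /andP[jk kn]|k kn]; last exact/g1/ltnW.
by apply: go; rewrite jk ltnW.
Qed.

Lemma inner_residual_out g n f k : orthonormal_or_zero g n.+1 -> (k <= n)%N ->
  B (residual g k f) (g n) = B f (g n).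
Proof.
move=> [go _] kn; rewrite innerBl// inner_suml// big_nat_cond big1 ?subr0// => i.
move=> /andP[/andP[_ ik] _]; rewrite innerZl// (innerC HB (g i)) go ?mulr0//.
by rewrite ltnSn andbT (leq_trans ik).
Qed.

Lemma residual_perp g n f : orthonormal_or_zero g n -> perp g n (residual g n f).
Proof.
elim: n => // n IH gn k; rewrite ltnS leq_eqVlt residualS innerBl// innerZl//.
have [go g1] := gn.
move=> /predU1P[->|kn].
  rewrite (inner_residual_out _ gn)//.
  case: (g1 n (ltnSn n)) => ->; first by rewrite mulr1 subrr.
  by rewrite !(inner0r HB) mulr0 subr0.
by rewrite (IH (orthonormal_or_zeroS gn) k kn) go ?ltnSn ?andbT// mulr0 subr0.
Qed.

Lemma inner_residual_perp g n f h : perp g n h -> B h (residual g n f) = B h f.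
Proof.
move=> hp; rewrite innerBr// (innerC HB h (\sum_(0 <= _ < _) _)).
rewrite inner_suml// big_nat_cond big1 ?subr0// => i.
by move=> /andP[/andP[_ ik] _]; rewrite innerZl// (innerC HB (g i)) hp// mulr0.
Qed.

Lemma nrm_residual g n f : orthonormal_or_zero g n ->
  nrm (residual g n f) ^+ 2 = B f f - \sum_(0 <= k < n) B f (g k) ^+ 2.
Proof.
elim: n => [|n IH] gn; rewrite nrm_sqr//.
  by rewrite /residual !big_geq// !subr0.
rewrite big_nat_recr//= residualS innerBB// -(nrm_sqr HB) IH; last first.
  exact: orthonormal_or_zeroS.
rewrite !(innerZr HB) !(innerZl HB). rewrite (inner_residual_out _ gn)//.
have [_ /(_ n (ltnSn n))[->|->]] := gn; first by ring.
by rewrite !(inner0r HB); ring.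
Qed.

Lemma nrm_residual_le g n f : orthonormal_or_zero g n ->
  nrm (residual g n f) <= nrm f.
Proof.
move=> gn; rewrite -ler_sqr ?nnegrE ?nrm_ge0// nrm_residual// -nrm_sqr//.
by rewrite gerBl sumr_ge0// => k _; rewrite sqr_ge0.
Qed.

Section BesselConsequences.
Variable g : nat -> V.
Hypothesis gN : forall n, orthonormal_or_zero g n.

Lemma is_cvg_Bessel f : cvgn (series (fun k => B f (g k) ^+ 2)).
Proof.
apply: nondecreasing_is_cvgn.
  apply/nondecreasing_seqP => n; rewrite /series/= big_nat_recr//=.
  by rewrite lerDl sqr_ge0.
exists (B f f) => _ [n _ <-]; rewrite /series/= -subr_ge0.
by rewrite -nrm_residual// sqr_ge0.
Qed.

Lemma orthonormal_weakly_null : weakly_null B g.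
Proof.
move=> f; have := cvg_series_cvg_0 (@is_cvg_Bessel f) => s0.
have -> : (fun n => B (g n) f) = (fun n => B f (g n)).
  by apply/funext => n; rewrite innerC.
exact: cvg0_sqr.
Qed.

(** The squared distance of two residuals is the difference of their squared
    norms, which converge by Bessel's inequality. *)
Lemma residual_cvg f : exists r, norm_cvg B (fun n => residual g n f) r.
Proof.
pose b n := nrm (residual g n f) ^+ 2.
have [L bL] : exists L : R, b n @[n --> \oo] --> L.
  have [S sS] := (cvg_ex _).1 (@is_cvg_Bessel f).
  exists (B f f - S); rewrite (_ : b = fun n => B f f - series (fun k => B f (g k) ^+ 2) n).
    by apply: cvgB => //; exact: cvg_cst.
  by apply/funext => n; rewrite /b nrm_residual.
have dist p q : (p <= q)%N -> nrm (residual g p f - residual g q f) ^+ 2 = b p - b q.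
  move=> pq; rewrite nrm_sqr// innerBB// (innerC HB (residual g p f) (residual g q f)).
  have rq : perp g q (residual g q f) by exact: residual_perp.
  have rp : perp g p (residual g q f) by move=> k kp; exact/rq/(leq_trans kp).
  rewrite (inner_residual_perp f rp).
  by rewrite /b !nrm_sqr// (inner_residual_perp f rq); ring.
apply: Bcomplete => e e0.
have e4 : 0 < e ^+ 2 / 4 by rewrite divr_gt0 ?exprn_gt0.
have [n0 _ Hn0] := (cvgrPdist_lt _ _).1 bL _ e4.
have bd k : (n0 <= k)%N -> `|L - b k| < e ^+ 2 / 4 by exact: Hn0.
have close p q : (n0 <= p)%N -> (p <= q)%N ->
    nrm (residual g p f - residual g q f) < e.
  move=> n0p pq; rewrite -ltr_sqr ?nnegrE ?nrm_ge0 ?ltW// dist//.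
  by have := bd _ n0p; have := bd _ (leq_trans n0p pq); rewrite !ltr_norml; lra.
exists n0 => m n mn0 nn0; have [mn|/ltnW nm] := leqP m n; first exact: close.
by rewrite nrmBC// close.
Qed.

End BesselConsequences.

(** * The spectral theorem for compact positive operators *)

Section Greedy.
Variables (K : {linear V -> V}) (e : V).
Hypotheses (Ksym : forall u v, B (K u) v = B u (K v))
  (Kpsd : forall u, 0 <= B (K u) u) (Kcc : completely_continuous B K)
  (Kbounded : exists C, forall u, nrm (K u) <= C * nrm u)
  (Knull : forall u, nrm u = 0 -> K u = 0)
  (e1 : B e e = 1) (Ke : K e = 0)
  (Kker : forall u, nrm (K u) = 0 -> B u e = 0 -> nrm u = 0).

(** The pair p is the eigenvector chosen after g_0, ..., g_(n-1), with its
    eigenvalue, which by [greedy_max] is the norm of K on their orthogonal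
    complement. The pair (0, 0) is taken when K vanishes there. *)
Record greedy_step (g : nat -> V) (n : nat) (p : V * R) : Prop := GreedyStep {
  greedy_perp : perp g n p.1;
  greedy_unit : 0 < p.2 /\ B p.1 p.1 = 1 \/ p = (0, 0);
  greedy_eigen : K p.1 = p.2 *: p.1;
  greedy_max : forall f, perp g n f -> nrm (K f) <= p.2 * nrm f }.

Lemma perp_comb g n a u v : perp g n u -> perp g n v -> perp g n (a *: u + v).
Proof. by move=> pu pv k kn; rewrite innerP// pu// pv// mulr0 addr0. Qed.

Lemma perpZ g n a u : perp g n u -> perp g n (a *: u).
Proof. by move=> pu k kn; rewrite innerZl// pu// mulr0. Qed.

(** On the complement of the eigenvectors already chosen, K divided by its norm
    l is a contraction; a maximizing sequence for l provides a vector w fixed by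
    it up to a null vector. *)
Lemma exists_top_eigenvector (g : nat -> V) (c : nat -> R) n :
  (forall k, (k < n)%N -> K (g k) = c k *: g k) -> orthonormal_or_zero g n ->
  exists p, greedy_step g n p.
Proof.
move=> Kg gn.
have KM u : perp g n u -> perp g n (K u).
  by move=> pu k kn; rewrite Ksym Kg// innerZr// pu// mulr0.
have [K0|] := pselect (forall f, perp g n f -> nrm (K f) = 0).
  exists (0, 0); split => /=; last by move=> f /K0 ->; rewrite mul0r.
  - by move=> k kn; rewrite inner0l.
  - by right.
  - by rewrite linear0 scaler0.
move=> /existsNP[f0 /not_implyP[Mf0 /eqP Kf0]].
have [C KC] := Kbounded.
pose S := [set nrm (K f) | f in [set f | perp g n f /\ nrm f <= 1]].
have S0 : S 0.
  by exists 0; [split; [move=> k kn|]|]; rewrite ?linear0 /nrm inner0l// sqrtr0.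
have S_sup : has_sup S.
  split; first by exists 0.
  exists `|C| => _ [f [_ f1] <-]; apply: le_trans (KC f) _.
  apply: le_trans (ler_norm _) _; rewrite normrM ler_piMr//.
  by rewrite ger0_norm ?nrm_ge0.
pose l := sup S.
have Sl f : perp g n f -> nrm f <= 1 -> nrm (K f) <= l.
  by move=> pf f1; apply: sup_upper_bound => //; exists f.
have Kl f : perp g n f -> nrm (K f) <= l * nrm f.
  move=> pf; have [f0'|f0'] := eqVneq (nrm f) 0.
    by rewrite Knull// f0' mulr0 /nrm inner0l// sqrtr0.
  have fp : 0 < nrm f by rewrite lt_neqAle eq_sym f0' nrm_ge0.
  have := Sl ((nrm f)^-1 *: f) (perpZ _ pf).
  rewrite linearZ/= !nrmZ// gtr0_norm ?invr_gt0// mulVf// => /(_ (lexx _)).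
  by rewrite mulrC ler_pdivrMr.
have l0 : 0 < l.
  have : 0 < nrm (K f0) by rewrite lt_neqAle eq_sym Kf0 nrm_ge0.
  move=> /lt_le_trans /(_ (Kl _ Mf0)); have := nrm_ge0 B f0; nra.
have /choice[f_ Hf] (i : nat) : exists f, [/\ perp g n f, nrm f <= 1 &
    l - i.+1%:R^-1 < nrm (K f)].
  have i0 : 0 < (i.+1%:R^-1 : R) by rewrite invr_gt0.
  have [_ [f [pf f1] <-] lf] := sup_adherent i0 S_sup.
  by exists f.
pose AL : {linear V -> V} := (l^-1 \*: K).
have nA f : nrm (AL f) = l^-1 * nrm (K f) by rewrite nrmZ// gtr0_norm ?invr_gt0.
have [w [Mw w0 Aw]] : exists w, [/\ perp g n w, nrm w != 0 & nrm (AL w - w) = 0].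
  apply: (@contraction_fixed_vector _ _ _ HB Bcomplete AL (perp g n) _ _ _ _ _ _ _ _ f_).
  - by move=> u v /=; rewrite innerZl// innerZr// Ksym.
  - by move=> u /=; rewrite innerZl// mulr_ge0// invr_ge0 ltW.
  - move=> u u1 uw; under eq_fun do rewrite nA.
    by rewrite -(mulr0 l^-1); apply: cvgM; [exact: cvg_cst|exact: Kcc].
  - by move=> *; exact: perp_comb.
  - by move=> u pu; apply: perpZ; exact: KM.
  - by move=> u v pu uv k kn; apply: (norm_cvg_innerl0 _ uv) => // i; exact: pu.
  - move=> v; exists (residual g n v); first exact: residual_perp.
    by move=> f pf; rewrite inner_residual_perp.
  - by move=> u pu; rewrite nA mulrC ler_pdivrMr// mulrC Kl.
  - by move=> i; have [] := Hf i.
  - by move=> i; have [] := Hf i.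
  apply: (@squeeze_cvgr _ _ _ _ (fun i => 1 - l^-1 * i.+1%:R^-1) (fun=> 1)).
  - near=> i; have [pf f1 lf] := Hf i; rewrite nA.
    rewrite ler_pdivrMl// mulr1 Sl// andbT.
    rewrite -(ler_pM2l l0) mulrBr mulrA divff ?gt_eqF// mulr1 mul1r.
    by rewrite mulrA divff ?gt_eqF// mul1r ltW.
  - rewrite -[X in _ --> X](subr0 1) -(mulr0 l^-1).
    apply: cvgB; first exact: cvg_cst.
    by apply: cvgM; [exact: cvg_cst|exact: cvg_harmonic].
  - exact: cvg_cst.
(* K maps the null vector AL w - w to 0, so that K w, unlike w itself, satisfies
   the eigenvector equation exactly. *)
have KAw : K (AL w) = K w by apply/eqP; rewrite -subr_eq0 -linearB/= Knull.
have Kw0 : nrm (K w) != 0.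
  apply: contraNneq w0 => Kw0; rewrite eq_le nrm_ge0 andbT.
  rewrite -(subKr (AL w) w) (le_trans (nrmD HB _ _))//.
  by rewrite nrmN// Aw addr0 nrmZ// Kw0 mulr0.
have Kwp : 0 < nrm (K w) by rewrite lt_neqAle eq_sym Kw0 nrm_ge0.
exists ((nrm (K w))^-1 *: K w, l); split => //=.
- by apply: perpZ; exact: KM.
- left; split => //; rewrite innerZl// innerZr// -(nrm_sqr HB).
  by field.
- rewrite linearZ/= scalerA mulrC -scalerA; congr (_ *: _).
  by rewrite -{2}KAw/= linearZ/= scalerA divff ?scale1r// gt_eqF.
Unshelve. all: by end_near. Qed.

Definition greedy_family (G : nat -> V * R) : Prop :=
  G 0%N = (e, 0) /\ forall n, greedy_step (fst \o G) n.+1 (G n.+1).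

(** The part of [greedy_family] that concerns indices below n. *)
Definition greedy_upto (G : nat -> V * R) n : Prop :=
  G 0%N = (e, 0) /\ forall m, (m.+1 < n)%N -> greedy_step (fst \o G) m.+1 (G m.+1).

Lemma greedy_step_ext g h n p : (forall k, (k < n)%N -> g k = h k) ->
  greedy_step g n p -> greedy_step h n p.
Proof.
move=> gh [pp pu pe pm]; split => //.
  by move=> k kn; rewrite -gh//; exact: pp.
by move=> f pf; apply: pm => k kn; rewrite gh//; exact: pf.
Qed.

Lemma greedy_orthonormal G n : greedy_upto G n -> orthonormal_or_zero (fst \o G) n.
Proof.
move=> [G0 GS]; split => [j [//|k] /andP[jk kn]|[|k] kn] /=.
- by have [+ _ _ _] := GS _ kn; apply.
- by left; rewrite G0.
- by have [_ [[_ ->]|->] _ _] := GS _ kn; [left|right].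
Qed.

Lemma greedy_eigenvector G n k : greedy_upto G n -> (k < n)%N ->
  K (G k).1 = (G k).2 *: (G k).1.
Proof.
move=> [G0 GS]; case: k => [_|k kn]; first by rewrite G0/= Ke scale0r.
by have [_ _ + _] := GS _ kn.
Qed.

Lemma exists_greedy_family : exists G, greedy_family G.
Proof.
pose next (h : nat -> V * R) n := xget (0, 0) [set p | greedy_step (fst \o h) n p].
(* H n has its final values at the indices k <= n. *)
pose fix H n : nat -> V * R :=
  if n is m.+1 then fun k => if k == n then next (H m) n else H m k
  else fun=> (e, 0).
pose G k := H k k.
have HG n k : (k <= n)%N -> H n k = G k.
  elim: n => [|n IH]; first by rewrite leqn0 => /eqP ->.
  rewrite leq_eqVlt => /predU1P[->//|]; rewrite ltnS => kn /=.
  by rewrite ltn_eqF ?ltnS// IH.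
have GS n : G n.+1 = next (H n) n.+1 by rewrite /G/= eqxx.
have up n : greedy_upto G n.
  split=> // m; elim: n m => // n IH m; rewrite ltnS leq_eqVlt.
  case/predU1P => [mn|]; last exact: IH.
  have un : greedy_upto G n by split.
  have [p Hp] := exists_top_eigenvector (fun k => @greedy_eigenvector G n k un)
    (greedy_orthonormal un).
  rewrite -mn in Hp; rewrite GS; apply: (@greedy_step_ext (fst \o H m)).
    by move=> k km /=; rewrite HG.
  apply: (@xgetPex _ (0, 0) [set p | greedy_step (fst \o H m) m.+1 p]).
  exists p; apply: greedy_step_ext Hp => k; rewrite ltnS => km /=.
  by rewrite HG.
exists G; split => // n; exact: (up n.+2).2.
Qed.

(** The eigenvalues tend to 0, since an orthonormal sequence is weakly null. They
    bound K on the residuals of f, so the limit r of the residuals satisfies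
    |K r| = 0 and (r, e) = 0. The system is cut at its first zero vector, after
    which all vectors are 0. *)
Lemma compact_spectral_theorem : exists (m : option nat) (g : nat -> V) (lam : nat -> R),
  [/\ forall k l, in_system m k -> in_system m l -> B (g k) (g l) = (k == l)%:R,
      forall k, ~~ in_system m k -> g k = 0,
      forall k, in_system m k -> K (g k) = lam k *: g k /\
        (g k = e /\ lam k = 0 \/ 0 < lam k)
    & forall f, nrm (residual g n f) @[n --> \oo] --> (0 : R)].
Proof.
have [G [G0 GS]] := exists_greedy_family.
pose g := fst \o G; pose lam := snd \o G.
have up n : greedy_upto G n by split.
have gN n : orthonormal_or_zero g n by exact: greedy_orthonormal.
have Kg k : K (g k) = lam k *: g k by exact: (greedy_eigenvector (up k.+1)).
have lam_ge0 k : 0 <= lam k.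
  case: k => [|k]; first by rewrite /lam/= G0.
  by have [_ [[/ltW//]|+] _ _] := GS k; rewrite /lam /= => ->.
have Klam k : lam k = nrm (K (g k)).
  rewrite Kg nrmZ// ger0_norm//; case: k => [|k].
    by rewrite /lam/= G0 mul0r.
  have [_ [[_ g1]|+] _ _] := GS k; last by rewrite /lam /= => ->; rewrite mul0r.
  by rewrite /nrm /g/= g1 sqrtr1 mulr1.
have lam0 : lam n @[n --> \oo] --> (0 : R).
  under eq_fun do rewrite Klam.
  apply: Kcc; last exact: orthonormal_weakly_null.
  move=> n; rewrite /nrm; have [_ /(_ n (ltnSn n))[->|->]] := gN n.+1.
    by rewrite sqrtr1.
  by rewrite inner0l// sqrtr0.
have res0 f : nrm (residual g n f) @[n --> \oo] --> (0 : R).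
  have [r fr] := residual_cvg gN f.
  have [C KC] := Kbounded.
  have Kr : nrm (K r) = 0.
    apply/eqP; rewrite eq_le nrm_ge0 andbT.
    pose b n := C * nrm (residual g n.+1 f - r) + lam n.+1 * nrm f.
    have b0 : b n @[n --> \oo] --> (0 : R).
      rewrite (_ : 0 = C * 0 + 0 * nrm f); last by rewrite mulr0 mul0r addr0.
      apply: cvgD; [apply: cvgM; first exact: cvg_cst|
                    apply: cvgM; last exact: cvg_cst].
        by rewrite (cvg_shiftS (fun n => nrm (residual g n f - r))).
      by rewrite (cvg_shiftS lam).
    apply: le0_cvg0 b0 => n.
    rewrite -{1}(subrK (residual g n.+1 f) r) linearD.
    apply: le_trans (nrmD HB _ _) _; apply: lerD.
      by rewrite nrmBC.
    apply: le_trans (greedy_max (GS n) (residual_perp f (gN n.+1))) _.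
    by rewrite ler_wpM2l ?nrm_residual_le//; exact: lam_ge0.
  have r0 : nrm r = 0.
    apply: Kker => //.
    have fr1 : norm_cvg B (fun n => residual g n.+1 f) r.
      by rewrite /norm_cvg (cvg_shiftS (fun n => nrm (residual g n f - r))).
    apply: (norm_cvg_innerl0 HB fr1) => n.
    by have := residual_perp f (gN n.+1) (ltn0Sn n); rewrite /g/= G0.
  apply: cvg0_le fr => n; rewrite nrm_ge0/=.
  rewrite -{1}(subrK r (residual g n f)).
  by apply: le_trans (nrmD HB _ _) _; rewrite r0 addr0.
have g0_neq0 : g 0%N <> 0.
  by rewrite /g/= G0/= => e0; have := e1; rewrite e0 inner0l// => /eqP; rewrite eq_sym oner_eq0.
have stop m k : g m = 0 -> (m <= k)%N -> g k = 0.
  case: m => // m gm0; rewrite leq_eqVlt => /predU1P[<-//|].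
  case: k => // k mk; have [pk [[lk _]|+] _ _] := GS k; last by rewrite /g/= => ->.
  have [_ _ _ /(_ (g k.+1))] := GS m.
  have pm : perp g m.+1 (g k.+1) by move=> i im; exact/pk/(ltn_trans im).
  have lm0 : lam m.+1 = 0 by rewrite Klam gm0 linear0 /nrm inner0l// sqrtr0.
  by move=> /(_ pm); rewrite -Klam (_ : (G m.+1).2 = 0)// mul0r leNgt lk.
have alt k : g k <> 0 -> B (g k) (g k) = 1 /\ (g k = e /\ lam k = 0 \/ 0 < lam k).
  move=> gk0; split; first by have [_ /(_ k (ltnSn k))[]] := gN k.+1.
  case: k gk0 => [_|k gk0]; first by left; rewrite /g /lam/= G0.
  right; have [_ [[//]|e0] _ _] := GS k.
  by case: gk0; rewrite /g/= e0.
have orth j k : j != k -> B (g j) (g k) = 0.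
  rewrite neq_ltn => /orP[] jk; last first.
    by have [+ _] := gN j.+1; apply; rewrite jk ltnSn.
  by have [+ _] := gN k.+1; rewrite innerC//; apply; rewrite jk ltnSn.
have [[m0 gm0]|nz] := pselect (exists m, g m = 0).
  have exm : exists m, `[< g m = 0 >] by exists m0; exact/asboolP.
  case: (ex_minnP exm) => m /asboolP gm mmin.
  have sysm k : in_system (Some m) k -> g k <> 0.
    by move=> /= km gk; have := mmin k; rewrite leqNgt km => /(_ (asboolT gk)).
  exists (Some m), g, lam; split => //.
  - move=> k l km lm; have [<-|kl] := eqVneq k l; last by rewrite orth.
    by have [] := alt _ (sysm _ km).
  - by move=> k /=; rewrite -leqNgt; exact: stop.
  - by move=> k km; split => //; have [] := alt _ (sysm _ km).
exists None, g, lam; split => //.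
- move=> k l _ _; have [<-|kl] := eqVneq k l; last by rewrite orth.
  by have [] := alt k (fun gk => nz (ex_intro _ k gk)).
- by move=> k _; split => //; have [] := alt k (fun gk => nz (ex_intro _ k gk)).
Qed.

End Greedy.

End Spectral.

(** * Integration tools *)

Lemma cvg_EFin_seq (R : realType) (w : nat -> R) (a : R) :
  w n @[n --> \oo] --> a -> (w n)%:E @[n --> \oo] --> a%:E.
Proof. by move=> wa; apply: cvg_EFin => //; exact: nearW. Qed.

Section IntegrabilityTools.
Context d (T : measurableType d) (R : realType).

Section DominatedConvergence.
Variables (mu : {measure set T -> \bar R}) (f_ : nat -> T -> R) (f g : T -> R).
Hypotheses (mf_ : forall n, measurable_fun setT (f_ n))
  (mf : measurable_fun setT f) (ig : mu.-integrable setT (EFin \o g))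
  (fg : forall n x, `|f_ n x| <= g x)
  (ff : forall x, f_ n x @[n --> \oo] --> f x).

Lemma dominated_cvg_integral :
  mu.-integrable setT (EFin \o f) /\
  (\int[mu]_x (f_ n x)%:E)%E @[n --> \oo] --> (\int[mu]_x (f x)%:E)%E.
Proof.
have emf_ n : measurable_fun setT (fun x => (f_ n x)%:E) by exact/measurable_EFinP.
have emf : measurable_fun setT (EFin \o f) by exact/measurable_EFinP.
have aff : {ae mu, forall x, setT x -> (f_ n x)%:E @[n --> \oo] --> (EFin \o f) x}.
  by apply: aeW => x _; exact: cvg_EFin_seq.
have afg : {ae mu, forall x n, setT x -> (`|(f_ n x)%:E| <= (EFin \o g) x)%E}.
  by apply: aeW => x n _ /=; rewrite lee_fin.
by have [] := dominated_convergence measurableT emf_ emf aff ig afg.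
Qed.

Lemma dominated_cvg_Rintegral :
  \int[mu]_x f_ n x @[n --> \oo] --> \int[mu]_x f x.
Proof.
have [fi c] := dominated_cvg_integral.
by apply: fine_cvg; rewrite fineK//; exact: integrable_fin_num.
Qed.

End DominatedConvergence.

Lemma integrable_bounded (mu : probability T R) (f : T -> R) (C : R) :
  measurable_fun setT f -> (forall x, `|f x| <= C) ->
  mu.-integrable setT (EFin \o f).
Proof.
move=> mf fC; have iC : mu.-integrable setT (EFin \o cst C).
  by apply: finite_measure_integrable_cst.
apply: le_integrable iC => //; first exact/measurable_EFinP.
by move=> x _ /=; rewrite lee_fin (le_trans (fC x))// ler_norm.
Qed.

Lemma integrableM_sqr (mu : {measure set T -> \bar R}) (f g : T -> R) :
  measurable_fun setT f -> measurable_fun setT g ->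
  mu.-integrable setT (fun x => (f x ^+ 2)%:E) ->
  mu.-integrable setT (fun x => (g x ^+ 2)%:E) ->
  mu.-integrable setT (fun x => (f x * g x)%:E).
Proof.
move=> mf mg f2 g2.
have : mu.-integrable setT (fun x => (f x ^+ 2 + g x ^+ 2)%:E).
  by apply: eq_integrable (integrableD measurableT f2 g2).
apply: le_integrable => //.
  by apply/measurable_EFinP; exact: measurable_funM.
move=> x _ /=; rewrite lee_fin [leRHS]ger0_norm ?addr_ge0 ?sqr_ge0//.
rewrite ler_norml; move: (f x) (g x) => a b.
by have := sqr_ge0 (a - b); have := sqr_ge0 (a + b); nra.
Qed.

Lemma EFin_Rintegral (mu : {measure set T -> \bar R}) (f : T -> R) :
  mu.-integrable setT (EFin \o f) ->
  (\int[mu]_x f x)%:E = (\int[mu]_x (f x)%:E)%E.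
Proof. by move=> fi; rewrite /Rintegral fineK//; exact: integrable_fin_num. Qed.

End IntegrabilityTools.

Lemma Rintegral_Fubini d1 d2 (T1 : measurableType d1) (T2 : measurableType d2)
    (R : realType) (m1 : {sigma_finite_measure set T1 -> \bar R})
    (m2 : {sigma_finite_measure set T2 -> \bar R}) (f : T1 -> T2 -> R) :
  (forall x, m2.-integrable setT (EFin \o f x)) ->
  (forall y, m1.-integrable setT (EFin \o f^~ y)) ->
  (m1 \x m2).-integrable setT (fun z => (f z.1 z.2)%:E) ->
  \int[m1]_x \int[m2]_y f x y = \int[m2]_y \int[m1]_x f x y.
Proof.
move=> f1 f2 If; congr fine.
transitivity (\int[m1]_x \int[m2]_y (f x y)%:E)%E.
  by apply: eq_integral => x _; rewrite EFin_Rintegral.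
rewrite (Fubini If)/=.
by apply: eq_integral => y _; rewrite EFin_Rintegral.
Qed.

Lemma measurable_fun_Rintegral d1 d2 (T1 : measurableType d1)
    (T2 : measurableType d2) (R : realType)
    (m2 : {sigma_finite_measure set T2 -> \bar R}) (f : T1 * T2 -> R) :
  measurable_fun setT f -> measurable_fun setT (fun x => \int[m2]_y f (x, y)).
Proof.
move=> mf; apply: measurableT_comp => //.
have mF : measurable_fun setT (EFin \o f) by exact/measurable_EFinP.
rewrite (_ : (fun _ => _) = fubini_F m2 (EFin \o f)^\+%E \- fubini_F m2 (EFin \o f)^\-%E)%E.
  apply: emeasurable_funB; apply: measurable_fun_fubini_tonelli_F => //.
    exact: measurable_funepos.
  exact: measurable_funeneg.
apply/funext=> x; rewrite [LHS]integralE; congr (_ - _)%E;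
  by apply: eq_integral => y _; rewrite ?funeposE ?funenegE.
Qed.

Lemma integrable_tensor d1 d2 (T1 : measurableType d1) (T2 : measurableType d2)
    (R : realType) (m1 : {sigma_finite_measure set T1 -> \bar R})
    (m2 : {sigma_finite_measure set T2 -> \bar R}) (a : T1 -> R) (b : T2 -> R) :
  m1.-integrable setT (EFin \o a) -> m2.-integrable setT (EFin \o b) ->
  (m1 \x m2).-integrable setT (fun z => (a z.1 * b z.2)%:E).
Proof.
move=> ia ib.
have ma : measurable_fun setT a by apply/measurable_EFinP; exact: measurable_int ia.
have mb : measurable_fun setT b by apply/measurable_EFinP; exact: measurable_int ib.
apply/integrable12ltyP.
  apply/measurable_EFinP; apply: measurable_funM.
    exact: measurableT_comp.
  exact: measurableT_comp.
under eq_integral => x _.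
  under eq_integral => y _ do rewrite /= normrM EFinM.
  rewrite ge0_integralZl//; last first.
    by apply/measurable_EFinP; exact: measurableT_comp.
  over.
rewrite ge0_integralZr//.
- move/integrableP: ia => [_ ia]; move/integrableP: ib => [_ ib].
  apply: lte_mul_pinfty => //; first exact: integral_ge0.
  by rewrite ge0_fin_numE//; exact: integral_ge0.
- by apply/measurable_EFinP; exact: measurableT_comp.
- exact: integral_ge0.
Qed.

(** * Square integrable functions *)

Section SquareIntegrable.
Context d (T : measurableType d) (R : realType) (mu : probability T R).

Lemma one_le_two : (1 <= 2%:E :> \bar R)%E.
Proof. by rewrite lee_fin ler1n. Qed.

Definition square_integrable := LfunType mu one_le_two.

Lemma Lfun2P (f : T -> R) : f \in Lfun mu 2%:E <->
  measurable_fun setT f /\ mu.-integrable setT (fun x => (f x ^+ 2)%:E).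
Proof.
split=> [f2|[mf f2]].
  split; last exact: Lfun2_integrable_sqr f2.
  by move: f2 => /andP[/[!inE]].
rewrite inE; apply/andP; split; rewrite inE//= /finite_norm unlock /Lnorm.
apply: poweR_lty => /=.
move/integrableP : f2 => [_]; apply: le_lt_trans.
rewrite le_eqVlt; apply/orP; left; apply/eqP; apply: eq_integral => x _ /=.
by rewrite powR_mulrn// normrX.
Qed.

Lemma le_Lfun2 (f : T -> R) (g : T -> R) : measurable_fun setT f ->
  mu.-integrable setT (EFin \o g) -> (forall x, f x ^+ 2 <= g x) ->
  f \in Lfun mu 2%:E.
Proof.
move=> mf ig fg; apply/Lfun2P; split => //.
apply: le_integrable ig => //.
  by apply/measurable_EFinP; exact: measurable_funX.
move=> x _ /=; rewrite lee_fin ger0_norm ?sqr_ge0//.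
exact: le_trans (fg x) (ler_norm _).
Qed.

Lemma Lfun2_integrable (f : T -> R) : f \in Lfun mu 2%:E ->
  mu.-integrable setT (EFin \o f).
Proof.
move=> f2; apply/Lfun1_integrable; apply: Lfun_subset12 f2.
exact: fin_num_measure.
Qed.

Lemma Lfun2_integrableM (f g : T -> R) :
  f \in Lfun mu 2%:E -> g \in Lfun mu 2%:E ->
  mu.-integrable setT (fun x => (f x * g x)%:E).
Proof. by move=> f2 g2; apply/Lfun1_integrable; exact: Lfun2_mul_Lfun1. Qed.

Lemma measurable_square_integrable (f : square_integrable) : measurable_fun setT f.
Proof. by have [] := (Lfun2P f).1 (LfunP f). Qed.

Definition inner (f g : T -> R) : R := \int[mu]_x (f x * g x).

Definition inner2 (f g : square_integrable) : R := inner f g.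

Lemma inner2_semi_inner : semi_inner inner2.
Proof.
split.
- by move=> u v; apply: eq_Rintegral => x _; rewrite mulrC.
- move=> a u v w; rewrite /inner2 /inner -RintegralZl//; last first.
    by apply: Lfun2_integrableM; exact: LfunP.
  rewrite -RintegralD//.
  + by apply: eq_Rintegral => x _ /=; rewrite mulrDl mulrA.
  + apply: (@integrableZl _ _ _ mu setT measurableT a (fun x => (u x * w x)%:E)).
    by apply: Lfun2_integrableM; exact: LfunP.
  + by apply: Lfun2_integrableM; exact: LfunP.
- by move=> u; apply: Rintegral_ge0 => x _; rewrite -expr2 sqr_ge0.
Qed.

Lemma inner_sqrE (f : T -> R) : f \in Lfun mu 2%:E ->
  (inner f f)%:E = (\int[mu]_x (f x ^+ 2)%:E)%E.
Proof.
move=> f2; rewrite /inner /Rintegral fineK.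
  by apply: eq_integral => x _; rewrite expr2.
by apply: integrable_fin_num => //; exact: Lfun2_integrableM.
Qed.

Lemma nrm2_sqrE (f : square_integrable) :
  (nrm inner2 f ^+ 2)%:E = (\int[mu]_x (f x ^+ 2)%:E)%E.
Proof. by rewrite nrm_sqr ?inner_sqrE ?LfunP//; exact: inner2_semi_inner. Qed.

Lemma integral_abs_le_nrm2 (f : square_integrable) :
  (\int[mu]_x (`|f x|)%:E <= (nrm inner2 f)%:E)%E.
Proof.
have fa2 : (fun x => `|f x|) \in Lfun mu 2%:E.
  have [mf f2] := (Lfun2P f).1 (LfunP f).
  apply: (@le_Lfun2 _ (fun x => f x ^+ 2)) => //; first exact: measurableT_comp.
  by move=> x; rewrite real_normK// num_real.
have c2 : (cst 1 : T -> R) \in Lfun mu 2%:E by exact: Lfun_cst.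
pose fa : square_integrable := Lfun_Sub _ fa2.
pose c : square_integrable := Lfun_Sub _ c2.
have B0 := inner2_semi_inner.
have := inner_le_nrmM B0 fa c.
have -> : nrm inner2 c = 1.
  rewrite /nrm /inner2 /inner (_ : \int[mu]_x _ = 1) ?sqrtr1//.
  rewrite /Rintegral; under eq_integral do rewrite /= mulr1.
  by rewrite integral_cst//= mul1e probability_setT.
have -> : nrm inner2 fa = nrm inner2 f.
  congr Num.sqrt; apply: eq_Rintegral => x _ /=.
  by rewrite -!expr2 real_normK// num_real.
rewrite mulr1; move/(le_trans (ler_norm _)); rewrite -lee_fin.
apply: le_trans; rewrite /inner2 /inner /Rintegral fineK//.
  by rewrite le_eqVlt; apply/orP; left; apply/eqP; apply: eq_integral => x _ /=; rewrite mulr1.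
by apply: integrable_fin_num => //; exact: Lfun2_integrableM.
Qed.

(** A subsequence v with |v_(k+1) - v_k| <= 2^-k has almost everywhere
    absolutely convergent increments, as their sum is integrable. *)
Lemma fast_Cauchy_ae_cvg (v : nat -> square_integrable) :
  (forall k, nrm inner2 (v k.+1 - v k) <= 2^-1 ^+ k) ->
  {ae mu, forall x, cvgn (fun k => v k x)}.
Proof.
move=> vk; pose D k x := (`|v k.+1 x - v k x|)%:E : \bar R.
have D0 k x : (0 <= D k x)%E by rewrite lee_fin.
have mD k : measurable_fun setT (D k).
  apply/measurable_EFinP; apply: measurableT_comp => //.
  by apply: measurable_funB; exact: measurable_square_integrable.
pose S x : \bar R := (\sum_(0 <= k <oo) D k x)%E.
have mS : measurable_fun setT S.
  apply: ge0_emeasurable_sum => [k x _ _|k _]; [exact: D0|exact: mD].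
have S_int : mu.-integrable setT S.
  apply/integrableP; split => //.
  rewrite (eq_integral S); last by move=> x _; rewrite gee0_abs// nneseries_ge0.
  rewrite integral_nneseries//.
  have part n : (\sum_(0 <= k < n) \int[mu]_x D k x <= 2%:E)%E.
    apply: (@le_trans _ _ (\sum_(0 <= k < n) (2^-1 ^+ k)%:E)%E).
      apply: lee_sum => k _; apply: le_trans (integral_abs_le_nrm2 (v k.+1 - v k)) _.
      by rewrite lee_fin.
    rewrite sumEFin lee_fin; have := @geometric_le_lim R n 1 2^-1.
    rewrite ger0_norm ?invr_ge0// /series/=.
    under eq_bigr do rewrite mul1r.
    move=> /(_ ler01); rewrite invr_gt0 => /(_ (ltr0Sn _ 1%N)).
    have h : (2^-1 : R) < 1 by lra.
    move=> /(_ h)/le_trans; apply; rewrite ler_pdivrMr; lra.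
  apply: (@le_lt_trans _ _ 2%:E); last exact: ltry.
  apply: lime_le.
    apply: is_cvg_nneseries => k _ _; apply: integral_ge0 => x _.
    by rewrite lee_fin.
  exact: nearW.
have := integrable_ae measurableT S_int; apply: filterS => x /(_ I) Sx.
have cs : cvgn (series (fun k => v k.+1 x - v k x)).
  apply: normed_cvg.
  rewrite [X in cvgn X](_ : _ = fun n => \sum_(0 <= k < n) `|v k.+1 x - v k x|)//.
  apply: nondecreasing_is_cvgn.
    by apply/nondecreasing_seqP => n; rewrite big_nat_recr//= lerDl.
  exists (fine (S x)) => _ [n _ <-].
  rewrite -lee_fin fineK// -sumEFin.
  exact: nneseries_lim_ge.
have -> : (fun k => v k x) =
    (fun k => v 0%N x + series (fun k => v k.+1 x - v k x) k).
  apply/funext => k; rewrite seriesEnat/= (@telescope_sumr _ 0 k (fun k => v k x))//.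
  by rewrite addrC subrK.
by apply: is_cvgD => //; exact: is_cvg_cst.
Qed.

(** The almost everywhere limit of a fast subsequence is the limit of the whole
    sequence by Fatou's lemma, which compares u_n with the entire subsequence. *)
Theorem square_integrable_complete : norm_complete inner2.
Proof.
move=> u Cu; have B0 := inner2_semi_inner.
have half_gt0 k : 0 < (2^-1 : R) ^+ k by rewrite exprn_gt0// invr_gt0.
have /choice[N HN] (k : nat) : exists n0 : nat, forall m n, (n0 <= m)%N -> (n0 <= n)%N ->
    nrm inner2 (u m - u n) < 2^-1 ^+ k by exact: Cu.
(* p is a nondecreasing majorant of N, so that v is a subsequence of u. *)
pose p k := (\sum_(i < k.+1) N i)%N.
have pN k : (N k <= p k)%N by rewrite /p big_ord_recr leq_addl.
have pmono k j : (k <= j)%N -> (p k <= p j)%N.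
  elim: j => [|j IH]; first by rewrite leqn0 => /eqP ->.
  rewrite leq_eqVlt => /predU1P[->//|/IH kj]; apply: leq_trans kj _.
  by rewrite [X in (_ <= X)%N]/p big_ord_recr leq_addr.
pose v k := u (p k).
have vfast := @fast_Cauchy_ae_cvg v (fun k => ltW (HN k _ _
  (leq_trans (pN k) (pmono _ _ (leqnSn k))) (pN k))).
pose l x := fine (limn_esup (fun k => (v k x)%:E)).
have ml : measurable_fun setT l.
  apply: measurableT_comp => //; apply: measurable_fun_limn_esup => k.
  exact/measurable_EFinP/measurable_square_integrable.
have fat n k : (N k <= n)%N ->
  (\int[mu]_x ((u n x - l x) ^+ 2)%:E <= ((2^-1 ^+ k) ^+ 2)%:E)%E.
  move=> kn; pose F j x := ((u n x - v (j + k)%N x) ^+ 2)%:E : \bar R.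
  have mF j : measurable_fun setT (F j).
    apply/measurable_EFinP; apply: measurable_funX.
    by apply: measurable_funB; exact: measurable_square_integrable.
  have F0 j x : (0 <= F j x)%E by rewrite lee_fin sqr_ge0.
  have FE : ae_eq mu setT (fun x => ((u n x - l x) ^+ 2)%:E) (fun x => limn_einf (F^~ x)).
    apply: filterS vfast => x /cvg_ex[L vL] _.
    have -> : l x = L.
      by rewrite /l (cvg_limn_einf_sup (cvg_EFin_seq vL)).2.
    apply/esym; apply: (cvg_limn_einf_sup _).1; apply: cvg_EFin_seq.
    have vkL : v (j + k)%N x @[j --> \oo] --> L by rewrite (cvg_shiftn k (fun j => v j x)).
    rewrite expr2; under eq_fun do rewrite /= expr2.
    by apply: cvgM; apply: cvgB => //; exact: cvg_cst.
  have mlF : measurable_fun setT (fun x => limn_einf (F^~ x)).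
    under eq_fun => x do rewrite -[limn_einf _]oppeK -limn_esupN.
    apply: measurableT_comp => //; apply: measurable_fun_limn_esup => j.
    exact: measurableT_comp.
  rewrite (@ae_eq_integral _ _ _ mu setT (fun x => limn_einf (F^~ x)) _ measurableT _ mlF FE)//; last first.
    apply/measurable_EFinP; apply: measurable_funX.
    by apply: measurable_funB => //; exact: measurable_square_integrable.
  apply: le_trans (fatou _ _ _ _) _ => //.
  rewrite limn_einf_lim; apply: lime_le; first exact: is_cvg_einfs.
  apply: nearW => j; apply: (@le_trans _ _ (\int[mu]_x F j x)%E).
    by apply: ereal_inf_lbound; exists j => /=.
  rewrite -(nrm2_sqrE (u n - v (j + k)%N)) lee_fin lerXn2r ?nnegrE ?nrm_ge0 ?ltW//.
  by apply: HN => //; apply: leq_trans (pmono _ _ (leq_addl j k)).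
have unL n : (N 0%N <= n)%N -> (fun x => u n x - l x) \in Lfun mu 2%:E.
  move=> /fat fn; apply/Lfun2P; split.
    by apply: measurable_funB => //; exact: measurable_square_integrable.
  apply/integrableP; split.
    apply/measurable_EFinP; apply: measurable_funX.
    by apply: measurable_funB => //; exact: measurable_square_integrable.
  under eq_integral do rewrite /= ger0_norm ?sqr_ge0//.
  exact: le_lt_trans fn (ltry _).
have lL : l \in Lfun mu 2%:E.
  pose w : square_integrable := Lfun_Sub _ (unL _ (leqnn _)).
  have -> : l = (u (N 0%N) - w : square_integrable).
    by apply/funext => x /=; rewrite /= opprB addrC subrK.
  exact: LfunP.
exists (Lfun_Sub _ lL).
apply/cvgr0Pnorm_lt => e e0.
have [k ke] : exists k, (2^-1 : R) ^+ k < e.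
  have := @cvg_geometric R 1 2^-1; rewrite ger0_norm ?invr_ge0//.
  have h : (2^-1 : R) < 1 by lra.
  move=> /(_ h)/cvgr0Pnorm_lt/(_ _ e0)[k _ /(_ k (leqnn k))] /=.
  by rewrite mul1r ger0_norm ?exprn_ge0 ?invr_ge0//; exists k.
exists (N k) => // n /= kn; rewrite ger0_norm ?nrm_ge0//.
apply: le_lt_trans ke; rewrite -ler_sqr ?nnegrE ?nrm_ge0 ?(ltW (half_gt0 k))//.
by rewrite -lee_fin nrm2_sqrE fat.
Qed.

End SquareIntegrable.

(** * Integral operators with square integrable kernels *)

Section KernelOperator.
Context d (T : measurableType d) (R : realType) (mu : probability T R).
Local Notation L2mu := (square_integrable mu).
Local Notation ip := (@inner2 _ _ _ mu).

Variable k : T -> T -> R.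
Hypotheses (mk : measurable_fun setT (fun z : T * T => k z.1 z.2))
  (ksym : forall x y, k x y = k y x)
  (ksec : forall x, k x \in Lfun mu 2%:E)
  (ksq : (mu \x mu).-integrable setT (fun z => (k z.1 z.2 ^+ 2)%:E)).

Definition section x : L2mu := Lfun_Sub _ (ksec x).

Lemma integrable_kernelM (f g : L2mu) :
  (mu \x mu).-integrable setT (fun z => (k z.1 z.2 * (f z.1 * g z.2))%:E).
Proof.
have [mf f2] := (Lfun2P mu f).1 (LfunP f).
have [mg g2] := (Lfun2P mu g).1 (LfunP g).
have fg2 := integrable_tensor f2 g2.
apply: integrableM_sqr => //.
  apply: measurable_funM; exact: measurableT_comp.
by apply: eq_integrable fg2 => // z _; rewrite exprMn.
Qed.

Definition apply_kernel (f : L2mu) x : R := ip (section x) f.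

Lemma apply_kernelE f x :
  (apply_kernel f x)%:E = (\int[mu]_y (k x y * f y)%:E)%E.
Proof.
rewrite /apply_kernel /inner2 /inner /Rintegral fineK//.
by apply: integrable_fin_num => //; apply: Lfun2_integrableM => //; exact: LfunP.
Qed.

Lemma measurable_apply_kernel f : measurable_fun setT (apply_kernel f).
Proof.
apply: (measurable_EFinP setT (apply_kernel f)).1.
pose c : L2mu := Lfun_Sub _ (Lfun_cst mu 1 2).
have := measurable_fubini_F (integrable_kernelM c f).
rewrite (_ : fubini_F _ _ = EFin \o apply_kernel f)//.
apply/funext => x; rewrite /= apply_kernelE; apply: eq_integral => y _.
by rewrite /= mul1r.
Qed.

Lemma integrable_section_sqr :
  mu.-integrable setT (fun x => (ip (section x) (section x))%:E).
Proof.
have := @integrable_fubini_F _ _ _ _ _ mu mu _ ksq; apply: eq_integrable => // x _.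
by rewrite /fubini_F /inner2 inner_sqrE//; exact: LfunP.
Qed.

Lemma apply_kernel_sqr_le f x :
  apply_kernel f x ^+ 2 <= ip (section x) (section x) * ip f f.
Proof. exact: (inner_le_sqr (inner2_semi_inner mu)). Qed.

Lemma apply_kernel_Lfun2 f : apply_kernel f \in Lfun mu 2%:E.
Proof.
apply: (@le_Lfun2 _ _ _ _ _ (fun x => ip (section x) (section x) * ip f f)).
- exact: measurable_apply_kernel.
- by apply: (integrableZr measurableT (ip f f) integrable_section_sqr).
- exact: apply_kernel_sqr_le.
Qed.

Definition kernel_operator f : L2mu := Lfun_Sub _ (apply_kernel_Lfun2 f).

Lemma kernel_operator_linear : linear kernel_operator.
Proof.
move=> a u v; apply/val_inj/funext => x /=.
have HB := inner2_semi_inner mu.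
by rewrite /apply_kernel innerDr// innerZr.
Qed.

HB.instance Definition _ :=
  GRing.isLinear.Build R L2mu L2mu *:%R kernel_operator kernel_operator_linear.

Lemma kernel_operator_sym u v :
  ip (kernel_operator u) v = ip u (kernel_operator v).
Proof.
apply: EFin_inj.
have E (f g : L2mu) : (ip (kernel_operator f) g)%:E =
    (\int[mu]_x \int[mu]_y (k x y * (g x * f y))%:E)%E.
  rewrite /inner2 /inner /Rintegral fineK; last first.
    by apply: integrable_fin_num => //; apply: Lfun2_integrableM => //; exact: LfunP.
  apply: eq_integral => x _; rewrite EFinM /= apply_kernelE muleC -integralZl//.
    by apply: eq_integral => y _; rewrite -EFinM; congr EFin; ring.
  by apply: Lfun2_integrableM => //; exact: LfunP.
rewrite E (innerC (inner2_semi_inner mu)) E.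
rewrite (@Fubini _ _ _ _ _ mu mu (fun z => (k z.1 z.2 * (v z.1 * u z.2))%:E))/=; last first.
  exact: integrable_kernelM.
apply: eq_integral => x _; apply: eq_integral => y _.
by rewrite ksym; congr EFin; ring.
Qed.

Lemma kernel_operator_bounded :
  exists C, forall u, nrm ip (kernel_operator u) <= C * nrm ip u.
Proof.
have HB := inner2_semi_inner mu.
pose S := \int[mu]_x ip (section x) (section x).
have S0 : 0 <= S by apply: Rintegral_ge0 => x _; exact: inner_ge0.
exists (Num.sqrt S) => u.
rewrite -ler_sqr ?nnegrE ?mulr_ge0 ?nrm_ge0 ?sqrtr_ge0//.
rewrite exprMn !nrm_sqr// sqr_sqrtr//.
rewrite /S -RintegralZr//; last exact: integrable_section_sqr.
apply: le_Rintegral => //.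
- by apply: Lfun2_integrableM => //; exact: LfunP.
- by apply: (integrableZr measurableT (ip u u) integrable_section_sqr).
- by move=> x _; rewrite -expr2; exact: apply_kernel_sqr_le.
Qed.

(** The equality is exact, as each value of K u is an inner product with u. *)
Lemma kernel_operator_null u : nrm ip u = 0 -> kernel_operator u = 0.
Proof.
move=> u0; apply/val_inj/funext => x /=.
have HB := inner2_semi_inner mu.
by rewrite /apply_kernel innerC//; exact: nrm_eq0_innerl.
Qed.

(** Weakly null means in particular that the values <k(x,.), u_n> = (K u_n)(x)
    tend to 0; they are dominated by |k(x,.)|, which is square integrable. *)
Lemma kernel_operator_completely_continuous :
  completely_continuous ip kernel_operator.
Proof.
have HB := inner2_semi_inner mu.
move=> u u1 uw.
have K0 x : apply_kernel (u n) x ^+ 2 @[n --> \oo] --> (0 : R).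
  have := uw (section x) => ux.
  have -> : (fun n => apply_kernel (u n) x ^+ 2) =
      (fun n => ip (u n) (section x) * ip (u n) (section x)).
    by apply/funext => n; rewrite expr2 /apply_kernel innerC.
  by rewrite -(mulr0 0); exact: cvgM.
have dom n x : `|apply_kernel (u n) x ^+ 2| <= ip (section x) (section x).
  rewrite ger0_norm ?sqr_ge0//; apply: le_trans (apply_kernel_sqr_le _ _) _.
  rewrite ler_piMr ?inner_ge0// -nrm_sqr// expr_le1 ?nrm_ge0//.
have [_] := dominated_cvg_integral
  (fun n => measurable_funX 2 (measurable_apply_kernel (u n)))
  (measurable_cst (0 : R)) integrable_section_sqr dom K0.
rewrite integral0; under eq_fun => n do rewrite -(nrm2_sqrE (kernel_operator (u n))).
by move=> /fine_cvg /= c; exact: cvg0_sqr.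
Qed.

End KernelOperator.

(** * The spectral theorem for positive kernels *)

Section KernelSpectralTheorem.
Context d (T : measurableType d) (R : realType) (mu : probability T R).
Local Notation L2mu := (square_integrable mu).
Local Notation ip := (@inner2 _ _ _ mu).
Variable k : T -> T -> R.
Hypotheses (mk : measurable_fun setT (fun z : T * T => k z.1 z.2))
  (ksym : forall x y, k x y = k y x)
  (ksec : forall x, k x \in Lfun mu 2%:E)
  (ksq : (mu \x mu).-integrable setT (fun z => (k z.1 z.2 ^+ 2)%:E)).
Local Notation K := (kernel_operator mk ksec ksq).
Local Notation section := (section ksec).

Lemma residual_at (g : nat -> L2mu) n f x :
  residual ip g n f x = f x - \sum_(0 <= i < n) ip f (g i) * g i x.
Proof.
elim: n => [|n IH]; first by rewrite /residual !big_geq// !subr0.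
by rewrite residualS big_nat_recr//= opprD addrA -IH.
Qed.

(** For every x the expansion of k(x,.) along a complete orthonormal system of
    eigenvectors has the coefficients lam_i g_i(x), so the errors converge to 0
    for every x, and they are dominated by |k(x,.)|^2. *)
Lemma kernel_expansion (g : nat -> L2mu) (lam : nat -> R) :
  (forall n, orthonormal_or_zero ip g n) ->
  (forall i x, apply_kernel ksec (g i) x = lam i * g i x) ->
  (forall f, nrm ip (residual ip g n f) @[n --> \oo] --> (0 : R)) ->
  (\int[mu \x mu]_z ((k z.1 z.2 -
      \sum_(0 <= i < n) lam i * g i z.1 * g i z.2) ^+ 2)%:E)%E @[n --> \oo] --> 0%E.
Proof.
move=> gN Kg res0; have HB := inner2_semi_inner mu.
have E n : (\int[mu \x mu]_z ((k z.1 z.2 -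
      \sum_(0 <= i < n) lam i * g i z.1 * g i z.2) ^+ 2)%:E)%E =
    (\int[mu]_x (nrm ip (residual ip g n (section x)) ^+ 2)%:E)%E.
  rewrite fubini_tonelli1/=; first last.
  - by move=> z; rewrite lee_fin sqr_ge0.
  - apply/measurable_EFinP; apply: measurable_funX; apply: measurable_funB => //.
    apply: measurable_sum => i; apply: measurable_funM.
      apply: measurable_funM => //.
      by apply: measurableT_comp => //; exact: measurable_square_integrable.
    by apply: measurableT_comp => //; exact: measurable_square_integrable.
  apply: eq_integral => x _; rewrite /fubini_F nrm2_sqrE.
  apply: eq_integral => y _; rewrite residual_at /=; congr (_ ^+ 2)%:E; congr (_ - _).
  by apply: eq_bigr => i _; rewrite -Kg.
under eq_fun do rewrite E.
rewrite -(integral0 mu setT).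
apply: (dominated_cvg_integral _ (measurable_cst (0 : R)) (integrable_section_sqr ksec ksq) _ _).2.
- move=> n; under eq_fun do rewrite nrm_residual//.
  apply: measurable_funB.
    by apply/measurable_EFinP; apply: measurable_int (integrable_section_sqr ksec ksq).
  apply: measurable_sum => i; apply: measurable_funX.
  exact: (measurable_apply_kernel mk ksec ksq).
- move=> n x; rewrite ger0_norm ?sqr_ge0// -nrm_sqr// ler_sqr ?nnegrE ?nrm_ge0//.
  exact: nrm_residual_le.
- move=> x; rewrite -(mulr0 0); under eq_fun do rewrite expr2.
  by apply: cvgM; exact: res0.
Qed.

Variable e : L2mu.
Hypotheses (e1 : ip e e = 1) (Ke : forall x, apply_kernel ksec e x = 0)
  (Kpsd : forall u, 0 <= ip (K u) u)
  (Kker : forall u, ip (K u) u = 0 -> ip u e = 0 -> nrm ip u = 0).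

Theorem kernel_spectral_theorem :
  exists (m : option nat) (g : nat -> L2mu) (lam : nat -> R),
  [/\ forall i j, in_system m i -> in_system m j -> ip (g i) (g j) = (i == j)%:R,
      forall i, in_system m i ->
        (forall x, apply_kernel ksec (g i) x = lam i * g i x) /\
        (g i = e /\ lam i = 0 \/ 0 < lam i),
      forall f : L2mu, exists a : nat -> R,
        (\int[mu]_x ((f x - \sum_(0 <= i < n | in_system m i) a i * g i x) ^+ 2)%:E)%E
          @[n --> \oo] --> 0%E
    & (\int[mu \x mu]_z ((k z.1 z.2 -
        \sum_(0 <= i < n | in_system m i) lam i * g i z.1 * g i z.2) ^+ 2)%:E)%E
          @[n --> \oo] --> 0%E].
Proof.
have HB := inner2_semi_inner mu.
have K0 : K e = 0 by apply/val_inj/funext => x; exact: Ke.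
have Kker' u : nrm ip (K u) = 0 -> ip u e = 0 -> nrm ip u = 0.
  by move=> Ku; apply: Kker; exact: nrm_eq0_innerl.
have [m [g [lam [gon gout geig gcomp]]]] := compact_spectral_theorem HB
  (@square_integrable_complete _ _ _ mu) (kernel_operator_sym mk ksym ksec ksq)
  Kpsd (kernel_operator_completely_continuous mk ksec ksq)
  (kernel_operator_bounded mk ksec ksq) (kernel_operator_null mk ksec ksq)
  e1 K0 Kker'.
have gN n : orthonormal_or_zero ip g n.
  split=> [i j /andP[ij _]|i _]; last first.
    have [im|/gout] := boolP (in_system m i); last by right.
    by left; rewrite gon// eqxx.
  have [im|/gout ->] := boolP (in_system m i); last by rewrite inner0r.
  have [jm|/gout ->] := boolP (in_system m j); last by rewrite inner0l.
  by rewrite gon// gtn_eqF.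
exists m, g, lam; split => //.
- move=> i im; have [Kg gl] := geig i im; split => // x.
  by have := congr1 (fun u : L2mu => u x) Kg.
- move=> f; exists (fun i => ip f (g i)).
  have := gcomp f => c.
  have c2 : nrm ip (residual ip g n f) ^+ 2 @[n --> \oo] --> (0 : R).
    by rewrite -(mulr0 0); under eq_fun do rewrite expr2; exact: cvgM.
  have := cvg_EFin_seq c2; apply: cvg_trans; apply: near_eq_cvg; apply: nearW => n.
  rewrite nrm2_sqrE; apply: eq_integral => x _; rewrite residual_at.
  congr ((_ - _) ^+ 2)%:E; rewrite [RHS]big_mkcond/=; apply: eq_bigr => i _.
  by case: ifPn => // /gout ->; rewrite mulr0.
have Kg i x : apply_kernel ksec (g i) x = (if in_system m i then lam i else 0) * g i x.
  case: ifPn => [/geig[Ki _]|/gout ->].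
    by have := congr1 (fun u : L2mu => u x) Ki.
  by rewrite mul0r /apply_kernel inner0r.
have := kernel_expansion gN Kg gcomp.
apply: cvg_trans; apply: near_eq_cvg; apply: nearW => n.
apply: eq_integral => z _; congr ((_ - _) ^+ 2)%:E.
by rewrite [RHS]big_mkcond/=; apply: eq_bigr => i _; case: ifPn; rewrite // !mul0r.
Qed.

End KernelSpectralTheorem.

(** * Steps and distances *)

Section Steps.
Context {R : realType}.
Local Notation leb := (@lebesgue_measure R).

Definition step (x t : R) : R := (x <= t)%R%:R.

Lemma step_indic (x a : R) : x <= a ->
  (fun t => step x t - step a t) = \1_(`[x, a[ : set R).
Proof.
move=> xa; apply/funext => t; rewrite /step indicE mem_setE in_itv/=.
have [xt|tx] := leP x t; have [at_|ta] := leP a t; rewrite ?subrr ?subr0//=.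
by have := lt_le_trans tx (le_trans xa at_); rewrite ltxx.
Qed.

Lemma step_ge0 x t : 0 <= step x t. Proof. exact: ler0n. Qed.
Lemma step_le1 x t : step x t <= 1. Proof. by rewrite /step lern1 leq_b1. Qed.

Lemma step_le x s t : s <= t -> step x s <= step x t.
Proof.
by move=> st; rewrite /step; case: (leP x s) => // /le_trans ->.
Qed.

Lemma step_anti x y t : x <= y -> step y t <= step x t.
Proof.
by move=> xy; rewrite /step; case: (leP y t) => // /(le_trans xy) ->.
Qed.

Lemma measurable_step : measurable_fun setT (fun z : R * R => step z.1 z.2).
Proof.
rewrite (_ : (fun _ => _) = \1_[set z : R * R | z.1 <= z.2]); last first.
  apply/funext => z; rewrite indicE /step; congr (nat_of_bool _)%:R.
  by apply/idP/idP => [?|/set_mem//]; exact: mem_set.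
apply: measurable_indic; rewrite -[X in measurable X]setTI.
exact: measurable_fun_le.
Qed.

Lemma measurable_stepl t : measurable_fun setT (step^~ t : R -> R).
Proof. exact: (measurableT_comp measurable_step (measurable_pair2 t)). Qed.

Lemma step_diff_le1 (x a t : R) : `|step x t - step a t| <= 1.
Proof.
have := step_ge0 x t; have := step_le1 x t.
by have := step_ge0 a t; have := step_le1 a t; rewrite ler_norml; lra.
Qed.

Definition step_diffM (x a y b t : R) : R :=
  (step x t - step a t) * (step y t - step b t).

(** This replaces a product of step differences of varying sign by nonnegative
    ones, for which integrability is a matter of finite integrals. *)
Lemma step_diffM_le (x y a b t : R) : `|step_diffM x a y b t| <=
  step_diffM x y x y t + step_diffM y a y b t.
Proof.
rewrite /step_diffM /step.
by case: (x <= t)%R; case: (y <= t)%R; case: (a <= t)%R; case: (b <= t)%R;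
  rewrite /= ?(subrr, subr0, sub0r, mulr0, mul0r, mulr1, mulrN, mulNr, opprK,
               normrN, normr0, normr1, addr0, add0r, lexx, ler01, lerDl).
Qed.

(** The function |x - y| is the integral of (step x - step y)^2; in the
    combination below the terms that depend on one variable only cancel. *)
Lemma integral_step_diffM (x a y b : R) :
  leb.-integrable setT (EFin \o step_diffM x a y b) /\
  \int[leb]_t step_diffM x a y b t =
  - 2^-1 * (`|x - y| - `|x - b| - `|a - y| + `|a - b|).
Proof.
wlog xa : x a / x <= a => [H|].
  have [xa|/ltW ax] := leP x a; first exact: H.
  have [ih eh] := H a x ax.
  have -> : step_diffM x a y b = (fun t => -1 * step_diffM a x y b t).
    by apply/funext => t; rewrite /step_diffM; ring.
  split; first exact: (integrableZl measurableT (-1) ih).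
  rewrite RintegralZl// eh; ring.
wlog yb : y b / y <= b => [H|].
  have [yb|/ltW byy] := leP y b; first exact: H.
  have [ih eh] := H b y byy.
  have -> : step_diffM x a y b = (fun t => -1 * step_diffM x a b y t).
    by apply/funext => t; rewrite /step_diffM; ring.
  split; first exact: (integrableZl measurableT (-1) ih).
  rewrite RintegralZl// eh; ring.
have -> : step_diffM x a y b = \1_(`[Num.max x y, Num.min a b[ : set R).
  have := step_indic xa; have := step_indic yb => Eb Ea; apply/funext => t.
  rewrite /step_diffM.
  have := congr1 (fun f => f t) Ea; have := congr1 (fun f => f t) Eb => /= -> ->.
  rewrite !indicE !mem_setE !in_itv/= -natrM mulnb ge_max lt_min.
  by congr (nat_of_bool _)%:R; rewrite andbACA.
split; first exact: integrable_indic_itv.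
rewrite /Rintegral integral_indic// setIT [X in fine X](lebesgue_measure_itv `[Num.max x y, Num.min a b[)/= lte_fin.
have [xy|xy] := leP x y; have [ab|ab] := leP a b; case: ifPn => /=;
  rewrite -?leNgt => h; have [?|?] := ger0P (x - y); have [?|?] := ger0P (x - b);
  have [?|?] := ger0P (a - y); have [?|?] := ger0P (a - b); lra.
Qed.

End Steps.

(** * Functions with vanishing integrals over half-lines *)

Section HalfLines.
Context {R : realType} (mu : probability R R).
Local Notation leb := (@lebesgue_measure R).
Variable f : R -> R.
Hypothesis fi : mu.-integrable setT (EFin \o f).

Definition half_line_integral t : R := \int[mu]_x (f x * step x t).

Let mf : measurable_fun setT f.
Proof. by apply/measurable_EFinP; exact: measurable_int fi. Qed.

(** The integral is right continuous in t, and every interval at the right of t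
    contains a point at which it vanishes. *)
Lemma half_line_integral_ae0 : {ae leb, forall t, half_line_integral t = 0} ->
  forall t, half_line_integral t = 0.
Proof.
move=> [N [mN N0 subN]] t.
have /choice[s Hs] (n : nat) : exists s : R,
    t < s < t + n.+1%:R^-1 /\ half_line_integral s = 0.
  apply: contrapT => nos.
  have sub : `]t, t + n.+1%:R^-1[ `<=` N.
    move=> s /=; rewrite in_itv/= => ts; apply: subN => /= s0; apply: nos.
    by exists s.
  have := @le_measure _ _ _ leb _ _ (mem_set (measurable_itv `]t, t + n.+1%:R^-1[)) (mem_set mN) sub.
  rewrite [X in (_ <= X)%E](_ : _ = 0%E); last exact: N0.
  rewrite [X in (X <= _)%E](lebesgue_measure_itv `]t, t + n.+1%:R^-1[)/= lte_fin ltrDl invr_gt0 ltr0Sn -EFinD lee_fin.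
  by rewrite addrC addKr leNgt invr_gt0 ltr0Sn.
have dom n x : `|f x * step x (s n)| <= `|f x|.
  by rewrite normrM ler_piMr// ger0_norm ?step_ge0 ?step_le1.
have lim x : f x * step x (s n) @[n --> \oo] --> f x * step x t.
  apply: cvgMl_tmp; apply: cvg_near_cst; have [xt|tx] := leP x t.
    near=> n; rewrite /step xt; congr (nat_of_bool _)%:R.
    by have [/andP[/ltW ts _] _] := Hs n; exact: le_trans ts.
  have e0 : 0 < x - t by rewrite subr_gt0.
  near=> n; rewrite /step (leNgt x t) tx/= leNgt.
  have [/andP[_ sn] _] := Hs n.
  have hn : n.+1%:R^-1 < x - t by near: n; exact: near_infty_natSinv_lt (PosNum e0).
  by rewrite (lt_trans sn)// -ltrBrDl.
have ms n : measurable_fun (setT : set R) (fun x => f x * step x (s n)).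
  by apply: measurable_funM => //; exact: measurable_stepl.
have m0 : measurable_fun (setT : set R) (fun x => f x * step x t).
  by apply: measurable_funM => //; exact: measurable_stepl.
have := dominated_cvg_Rintegral ms m0 (integrable_norm fi) dom lim.
rewrite -/(half_line_integral t).
under eq_fun => n do rewrite -/(half_line_integral (s n)) (Hs n).2.
by move=> c; apply: cvg_unique c (cvg_cst 0).
Unshelve. all: by end_near. Qed.

(** The sets over which f has integral 0 form a Dynkin system; it contains the
    open half-lines, which generate the Borel sets. *)
Lemma half_line_integral0_ae0 : \int[mu]_x f x = 0 ->
  (forall t, half_line_integral t = 0) -> ae_eq mu setT (EFin \o f) (cst 0%E).
Proof.
move=> f0 H0.
have fT0 : (\int[mu]_x (f x)%:E = 0)%E by rewrite -EFin_Rintegral// f0.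
apply: integral_ae_eq => // E _ mE; rewrite integral0.
have fS (A : set R) : measurable A -> mu.-integrable A (EFin \o f).
  by move=> mA; exact: integrableS fi.
have splitT (A : set R) : measurable A ->
    (\int[mu]_x (f x)%:E = \int[mu]_(x in A) (f x)%:E + \int[mu]_(x in ~` A) (f x)%:E)%E.
  move=> mA; rewrite -integral_setU//.
  - by rewrite setUv.
  - exact: measurableC.
  - by apply/measurable_EFinP; rewrite setUv.
  - by apply/disj_setPCl.
have compl (A : set R) : measurable A -> (\int[mu]_(x in A) (f x)%:E = 0)%E ->
    (\int[mu]_(x in ~` A) (f x)%:E = 0)%E.
  by move=> mA A0; have := splitT _ mA; rewrite fT0 A0 add0e.
suff : forall A : set R, <<s @RGenOInfty.G R >> A -> (\int[mu]_(x in A) (f x)%:E = 0)%E.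
  have EG : (@RGenOInfty.G R).-sigma.-measurable E by rewrite -RGenOInfty.measurableE.
  by apply.
refine (@dynkin_induction _ R (@RGenOInfty.G R)
  (fun A => (\int[mu]_(x in A) (f x)%:E = 0)%E) _ _ _ _ _ _) => //.
- exact: RGenOInfty.measurableE.
- move=> _ _ [x ->] [y ->]; exists (Num.max x y).
  by apply/seteqP; split => z /=; rewrite !in_itv/= !andbT gt_max => /andP.
- move=> _ [t ->]; rewrite -setCitvl; apply: compl => //.
  rewrite integral_mkcond -[RHS](congr1 EFin (H0 t)) EFin_Rintegral; last first.
    apply: le_integrable fi => //.
      apply/measurable_EFinP; apply: measurable_funM => //; exact: measurable_stepl.
    move=> x _ /=; rewrite lee_fin normrM ler_piMr//.
    by rewrite ger0_norm ?step_ge0 ?step_le1.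
  apply: eq_integral => x _; rewrite patchE /step.
  have [xt|tx] := leP x t.
    by rewrite mem_set ?mulr1//= in_itv.
  by rewrite memNset ?mulr0//= in_itv/= leNgt tx.
- move=> F mF tF F0; rewrite integral_bigcup//; last first.
    by apply: fS; apply: bigcup_measurable => k _; exact: mF.
  by rewrite eseries0 => [|i _ _] //; exact: F0.
Qed.

End HalfLines.

(** * The energy kernel *)

Section CenteredSteps.
Context {R : realType} (mu : probability R R).
Local Notation leb := (@lebesgue_measure R).

Definition mean_step (t : R) : R := \int[mu]_x step x t.

Definition centered_step (x t : R) : R := step x t - mean_step t.
Local Notation phi := centered_step.

Lemma integrable_stepl t : mu.-integrable setT (fun x => (step x t)%:E).
Proof.
apply: (@integrable_bounded _ _ _ mu _ 1); first exact: measurable_stepl.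
by move=> x; rewrite ger0_norm ?step_ge0 ?step_le1.
Qed.

Lemma Rintegral_prob_cst (c : R) : \int[mu]_x c = c.
Proof. by rewrite Rintegral_cst//= (_ : mu setT = 1%E) ?mulr1//; exact: probability_setT. Qed.

Lemma mean_step_ge0 t : 0 <= mean_step t.
Proof. by apply: Rintegral_ge0 => x _; exact: step_ge0. Qed.

Lemma mean_step_le1 t : mean_step t <= 1.
Proof.
rewrite -[leRHS]Rintegral_prob_cst; apply: le_Rintegral => //.
- exact: integrable_stepl.
- exact: finite_measure_integrable_cst.
- by move=> x _; exact: step_le1.
Qed.

Lemma measurable_mean_step : measurable_fun setT mean_step.
Proof.
apply: nondecreasing_measurable => // s t st.
apply: le_Rintegral => //; try exact: integrable_stepl.
by move=> x _; exact: step_le.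
Qed.

Lemma measurable_centered_step : measurable_fun setT (fun z : R * R => phi z.1 z.2).
Proof.
apply: measurable_funB; first exact: measurable_step.
by apply: measurableT_comp => //; exact: measurable_mean_step.
Qed.

Lemma measurable_centered_stepr x : measurable_fun setT (phi x).
Proof.
exact: (measurableT_comp measurable_centered_step (measurable_pair1 x)).
Qed.

Lemma measurable_centered_stepl t : measurable_fun setT (phi^~ t : R -> R).
Proof. by apply: measurable_funB => //; exact: measurable_stepl. Qed.

Lemma centered_step_le1 x t : `|phi x t| <= 1.
Proof.
rewrite ler_norml /phi; have := mean_step_ge0 t; have := mean_step_le1 t.
have := step_ge0 x t; have := step_le1 x t; lra.
Qed.

Lemma integral_centered_step t : \int[mu]_x phi x t = 0.
Proof.
rewrite RintegralB//; last 2 first.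
- exact: integrable_stepl.
- exact: finite_measure_integrable_cst.
by rewrite Rintegral_prob_cst subrr.
Qed.

(** The mean of |phi(Z,t)| is 2F(1-F), while |phi(x,t)| is F or 1-F. *)
Lemma integral_abs_centered_step_le x t : \int[mu]_y `|phi y t| <= 2 * `|phi x t|.
Proof.
have E y : `|phi y t| = (1 - 2 * mean_step t) * step y t + mean_step t.
  rewrite /phi /step; case: (y <= t)%R => /=.
    by rewrite ger0_norm ?subr_ge0 ?mean_step_le1//; ring.
  by rewrite sub0r normrN ger0_norm ?mean_step_ge0//; ring.
under eq_Rintegral do rewrite E.
rewrite RintegralD//; last 2 first.
- exact: (integrableZl measurableT (1 - 2 * mean_step t) (integrable_stepl t)).
- exact: finite_measure_integrable_cst.
rewrite RintegralZl//; last exact: integrable_stepl.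
rewrite Rintegral_prob_cst E -/(mean_step t).
have := mean_step_ge0 t; have := mean_step_le1 t.
by rewrite /step; case: (x <= t)%R => /=; nra.
Qed.

Hypothesis phi_sqr : forall x, leb.-integrable setT (fun t => (phi x t ^+ 2)%:E).

(** The kernel h_F in the form that does not presuppose a mean, see
    [h_kernelE]. *)
Definition energy_kernel x y : R := \int[leb]_t (phi x t * phi y t).
Local Notation h := energy_kernel.

Lemma energy_kernel_sym x y : h x y = h y x.
Proof. by apply: eq_Rintegral => t _; rewrite mulrC. Qed.

Lemma integrable_energy x y : leb.-integrable setT (fun t => (phi x t * phi y t)%:E).
Proof. by apply: integrableM_sqr => //; exact: measurable_centered_stepr. Qed.

(** E h(x,Z) is the integral of phi(x,t) E phi(Z,t) over t. The interchange is
    justified by E |phi(Z,t)| <= 2 |phi(x,t)|, as phi(x,.) is square integrable. *)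
Lemma integral_energy_kernel x : \int[mu]_y h x y = 0.
Proof.
have mf : measurable_fun setT (fun z : R * R => (phi x z.2 * phi z.1 z.2)%:E).
  apply/measurable_EFinP; apply: measurable_funM; last exact: measurable_centered_step.
  by apply: measurableT_comp => //; exact: measurable_centered_stepr.
have iphi t : mu.-integrable setT (EFin \o phi^~ t).
  apply: (@integrable_bounded _ _ _ mu _ 1); first exact: measurable_centered_stepl.
  by move=> y; exact: centered_step_le1.
have If : (mu \x leb).-integrable setT (fun z : R * R => (phi x z.2 * phi z.1 z.2)%:E).
  apply/integrable21ltyP => //=.
  have i2 : leb.-integrable setT (fun t => (2 * phi x t ^+ 2)%:E).
    exact: (integrableZl measurableT 2 (phi_sqr x)).
  move/integrableP: i2 => [mi2]; apply: le_lt_trans.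
  apply: ge0_le_integral => //.
  - by move=> t _; exact: integral_ge0.
  - have mabs := measurableT_comp (@abse_measurable R _) mf.
    have := @measurable_fun_fubini_tonelli_G _ _ _ _ _ mu _ mabs (fun z => abse_ge0 _).
    exact.
  - exact: measurableT_comp.
  move=> t _; under eq_integral do rewrite /= normrM EFinM.
  rewrite ge0_integralZl//; last first.
    by apply/measurable_EFinP; apply: measurableT_comp => //; exact: measurable_centered_stepl.
  rewrite -EFin_Rintegral; last exact: integrable_norm.
  have E : `|2 * phi x t ^+ 2| = `|phi x t| * (2 * `|phi x t|).
    by rewrite normrM normrX ger0_norm//; ring.
  by rewrite -EFinM /= lee_fin E ler_wpM2l// integral_abs_centered_step_le.
rewrite (Rintegral_Fubini _ _ If).
- under eq_Rintegral => t _ do rewrite RintegralZl// integral_centered_step mulr0.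
  by rewrite Rintegral_cst// mul0r.
- by move=> y; exact: integrable_energy.
- by move=> t; exact: (integrableZl measurableT (phi x t) (iphi t)).
Qed.

Lemma measurable_energy_kernel : measurable_fun setT (fun z : R * R => h z.1 z.2).
Proof.
have m3 : measurable_fun setT (fun z : (R * R) * R => phi z.1.1 z.2 * phi z.1.2 z.2).
  apply: measurable_funM.
    apply: (measurableT_comp measurable_centered_step (g := fun z : (R * R) * R => (z.1.1, z.2))).
    apply: measurable_fun_pair => //.
    exact: measurableT_comp.
  apply: (measurableT_comp measurable_centered_step (g := fun z : (R * R) * R => (z.1.2, z.2))).
  apply: measurable_fun_pair => //.
  exact: measurableT_comp.
exact: (@measurable_fun_Rintegral _ _ _ _ _ leb _ m3).
Qed.

Lemma energy_kernel_Lipschitz x x' y : `|h x y - h x' y| <= `|x - x'|.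
Proof.
have [isd sd] := integral_step_diffM x x' x x'.
have E t : phi x t * phi y t - phi x' t * phi y t = (step x t - step x' t) * phi y t.
  by rewrite /phi; ring.
rewrite /h -RintegralB//; last 2 first.
- exact: integrable_energy.
- exact: integrable_energy.
have ib := integrableB measurableT (integrable_energy x y) (integrable_energy x' y).
apply: le_trans (le_normr_Rintegral _ ib) _ => //.
have -> : `|x - x'| = \int[leb]_t step_diffM x x' x x' t.
  by rewrite sd !subrr normr0 (distrC x' x); field.
apply: le_Rintegral => //; first exact: integrable_norm ib.
move=> t _; rewrite E normrM /step_diffM.
have -> : (step x t - step x' t) * (step x t - step x' t) = `|step x t - step x' t|.
  rewrite /step; case: (x <= t)%R; case: (x' <= t)%R; rewrite /= ?subrr ?subr0 ?sub0r ?normr0 ?normr1 ?normrN1; ring.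
by rewrite ler_piMr// centered_step_le1.
Qed.

Hypothesis h_sqr : (mu \x mu).-integrable setT (fun z : R * R => (h z.1 z.2 ^+ 2)%:E).

(** Square integrability holds for almost every section, hence for one, and
    passes to all the others, from which it differs by a bounded function. *)
Lemma energy_section_Lfun2 x : h x \in Lfun mu 2%:E.
Proof.
have msec x1 : measurable_fun setT (h x1).
  exact: (measurableT_comp measurable_energy_kernel (measurable_pair1 x1)).
have [x0 i0] : exists x0, mu.-integrable setT (fun y => (h x0 y ^+ 2)%:E).
  have [N [mN N0 sub]] := ae_integrable1 h_sqr.
  apply: contrapT => noi.
  have NT : N = setT.
    by apply/seteqP; split => // x1 _; apply: sub => /= ix; apply: noi; exists x1.
  have : mu setT = 1%E by exact: probability_setT.
  by rewrite -NT N0 => /eqP; rewrite eq_sym onee_eq0.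
have i1 : mu.-integrable setT (fun y => (2 * h x0 y ^+ 2 + 2 * `|x - x0| ^+ 2)%:E).
  have := integrableD measurableT (integrableZl measurableT 2 i0)
    (finite_measure_integrable_cst mu (2 * `|x - x0| ^+ 2) measurableT).
  by apply: eq_integrable.
refine (@le_Lfun2 _ _ _ mu (h x) _ (msec x) i1 _) => y.
have hh : (h x y - h x0 y) ^+ 2 <= `|x - x0| ^+ 2.
  by rewrite -(real_normK (num_real (h x y - h x0 y))) lerXn2r ?nnegrE// energy_kernel_Lipschitz.
have := sqr_ge0 (h x y - 2 * h x0 y); nra.
Qed.

(** The covariance of f(Z) and 1{Z <= t}, when f(Z) has a mean. *)
Definition profile (f : R -> R) t : R := \int[mu]_x (f x * phi x t).

Lemma measurable_profile (f : R -> R) :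
  measurable_fun setT f -> measurable_fun setT (profile f).
Proof.
move=> mf.
have m2 : measurable_fun setT (fun z : R * R => f z.2 * phi z.2 z.1).
  apply: measurable_funM; first exact: measurableT_comp.
  apply: (measurableT_comp measurable_centered_step (g := fun z : R * R => (z.2, z.1))).
  exact: measurable_fun_pair.
exact: (@measurable_fun_Rintegral _ _ _ _ _ mu _ m2).
Qed.

(** Fubini's theorem for the pairing of centered steps with psi in L^2(dt):
    when f vanishes outside [-n, n], the integrand is dominated by
    (|phi(-n,t)| + |phi(n,t)|) |psi(t)|, as phi(x,t) is monotone in x. *)
Section CompactSupport.
Variables (f : R -> R) (C n : R).
Hypotheses (mf : measurable_fun setT f) (fC : forall x, `|f x| <= C)
  (fn : forall x, n < `|x| -> f x = 0).

Let dom t := C * (`|phi (- n) t| + `|phi n t|).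

Lemma compact_support_dom x t : `|f x * phi x t| <= dom t.
Proof.
have C0 : 0 <= C by exact: le_trans (fC 0).
have [nx|xn] := ltP n `|x|.
  by rewrite fn// mul0r normr0 mulr_ge0// addr_ge0.
rewrite normrM ler_pM//.
move: xn; rewrite ler_norml => /andP[nx xn].
have := step_anti t nx; have := step_anti t xn.
have := ler_norm (phi (- n) t); have := ler_norm (- phi n t); rewrite normrN.
have := normr_ge0 (phi (- n) t); have := normr_ge0 (phi n t).
by rewrite ler_norml /phi; lra.
Qed.

Let measurable_dom : measurable_fun setT dom.
Proof.
apply: measurable_funM => //; apply: measurable_funD;
  by apply: measurableT_comp => //; exact: measurable_centered_stepr.
Qed.

Let integrable_dom_sqr : leb.-integrable setT (fun t => (dom t ^+ 2)%:E).
Proof.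
have i2 : leb.-integrable setT
    (fun t => (2 * C ^+ 2 * (phi (- n) t ^+ 2 + phi n t ^+ 2))%:E).
  have i1 := integrableD measurableT (phi_sqr (- n)) (phi_sqr n).
  by apply: eq_integrable (integrableZl measurableT (2 * C ^+ 2) i1).
apply: le_integrable i2 => //; first by apply/measurable_EFinP; exact: measurable_funX.
move=> t _ /=; rewrite lee_fin ger0_norm ?sqr_ge0//; apply: le_trans (ler_norm _).
rewrite /dom exprMn -[phi (- n) t ^+ 2]real_normK ?num_real//.
rewrite -[phi n t ^+ 2]real_normK ?num_real//.
move: `|phi (- n) t| `|phi n t| => a b.
by have := mulr_ge0 (sqr_ge0 C) (sqr_ge0 (a - b)); nra.
Qed.

Lemma integrable_profile_integrand t :
  mu.-integrable setT (fun x => (f x * phi x t)%:E).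
Proof.
apply: (@integrable_bounded _ _ _ mu (fun x => f x * phi x t) (dom t)).
  by apply: measurable_funM => //; exact: measurable_centered_stepl.
by move=> x; exact: compact_support_dom.
Qed.

Lemma integrable_profile_sqr : leb.-integrable setT (fun t => (profile f t ^+ 2)%:E).
Proof.
apply: le_integrable integrable_dom_sqr => //.
  by apply/measurable_EFinP; apply: measurable_funX; exact: measurable_profile.
move=> t _ /=; rewrite lee_fin !ger0_norm ?sqr_ge0//.
rewrite -[profile f t ^+ 2]real_normK ?num_real// lerXn2r ?nnegrE//.
  exact: (le_trans (normr_ge0 _) (compact_support_dom 0 t)).
apply: le_trans (le_normr_Rintegral _ (integrable_profile_integrand t)) _ => //.
rewrite -[leRHS](@Rintegral_prob_cst).
apply: le_Rintegral => //.
- exact: integrable_norm (integrable_profile_integrand t).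
- exact: finite_measure_integrable_cst.
- by move=> x _; exact: compact_support_dom.
Qed.

Lemma compact_support_Fubini (psi : R -> R) : measurable_fun setT psi ->
  leb.-integrable setT (fun t => (psi t ^+ 2)%:E) ->
  \int[mu]_x (f x * \int[leb]_t (phi x t * psi t)) =
  \int[leb]_t (profile f t * psi t).
Proof.
move=> mpsi psi2.
have iphipsi x : leb.-integrable setT (fun t => (phi x t * psi t)%:E).
  by apply: integrableM_sqr => //; exact: measurable_centered_stepr.
have If : (mu \x leb).-integrable setT
    (fun z : R * R => (f z.1 * phi z.1 z.2 * psi z.2)%:E).
  have i1 : mu.-integrable setT (EFin \o cst 1) by exact: finite_measure_integrable_cst.
  have i2 : leb.-integrable setT (fun t => (dom t * psi t)%:E) by exact: integrableM_sqr.
  have := integrable_tensor i1 i2; apply: le_integrable => //.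
    apply/measurable_EFinP; apply: measurable_funM; last exact: measurableT_comp.
    apply: measurable_funM; first exact: measurableT_comp.
    exact: measurable_centered_step.
  move=> z _ /=; rewrite lee_fin mul1r normrM [leRHS]normrM ler_wpM2r//.
  exact: (le_trans (compact_support_dom _ _) (ler_norm _)).
transitivity (\int[mu]_x \int[leb]_t (f x * phi x t * psi t)).
  apply: eq_Rintegral => x _; rewrite -RintegralZl//; last exact: iphipsi.
  by apply: eq_Rintegral => t _; rewrite mulrA.
rewrite (Rintegral_Fubini _ _ If).
- apply: eq_Rintegral => t _; rewrite RintegralZr//.
  exact: integrable_profile_integrand.
- move=> x; apply: eq_integrable (integrableZl measurableT (f x) (iphipsi x)) => //.
  by move=> t _; rewrite /= -mulrA.
- move=> t; exact: (integrableZr measurableT (psi t) (integrable_profile_integrand t)).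
Qed.

(** Fubini's theorem is applied first to psi = phi(x,.), then to psi = profile f. *)
Lemma compact_support_energy :
  \int[mu]_x (f x * \int[mu]_y (h x y * f y)) = \int[leb]_t (profile f t ^+ 2).
Proof.
transitivity (\int[mu]_x (f x * \int[leb]_t (phi x t * profile f t))).
  apply: eq_Rintegral => x _; congr (_ * _).
  transitivity (\int[mu]_y (f y * \int[leb]_t (phi y t * phi x t))).
    by apply: eq_Rintegral => y _; rewrite energy_kernel_sym mulrC.
  rewrite (compact_support_Fubini (measurable_centered_stepr x) (phi_sqr x)).
  by apply: eq_Rintegral => t _; rewrite mulrC.
rewrite (compact_support_Fubini (measurable_profile mf) integrable_profile_sqr).
by apply: eq_Rintegral => t _; rewrite expr2.
Qed.

End CompactSupport.

(** * The energy inequality *)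

Local Notation L2mu := (square_integrable mu).
Local Notation ip := (@inner2 _ _ _ mu).
Local Notation K :=
  (@kernel_operator _ _ _ mu h measurable_energy_kernel energy_section_Lfun2 h_sqr).

(** Without truncation the integral of |phi(x,t) phi(y,t) f(x) f(y)| over x, y
    and t has no evident bound, although h is square integrable. *)
Definition truncate (f : R -> R) (n : nat) (x : R) : R :=
  if (`|x| <= n%:R) && (`|f x| <= n%:R) then f x else 0.

Lemma truncate_le f n x : `|truncate f n x| <= `|f x|.
Proof. by rewrite /truncate; case: ifP; rewrite // normr0. Qed.

Lemma truncate_bounded f n x : `|truncate f n x| <= n%:R.
Proof. by rewrite /truncate; case: ifP => [/andP[]|]; rewrite ?normr0. Qed.

Lemma truncate_out f n x : n%:R < `|x| -> truncate f n x = 0.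
Proof. by rewrite /truncate ltNge => /negbTE ->. Qed.

Lemma measurable_truncate f n : measurable_fun setT f ->
  measurable_fun setT (truncate f n).
Proof.
move=> mf; apply: measurable_fun_ifT => //.
by apply: measurable_and; apply: measurable_fun_ler => //; apply: measurableT_comp.
Qed.

Lemma cvg_truncate f x : truncate f n x @[n --> \oo] --> f x.
Proof.
apply: cvg_near_cst; near=> n; rewrite /truncate.
have xn : `|x| <= n%:R by near: n; exact: nbhs_infty_ger.
have fn : `|f x| <= n%:R by near: n; exact: nbhs_infty_ger.
by rewrite xn fn.
Unshelve. all: by end_near. Qed.

Lemma truncate_Lfun2 (u : L2mu) n : truncate u n \in Lfun mu 2%:E.
Proof.
have [mu_ u2] := (Lfun2P mu u).1 (LfunP u).
refine (@le_Lfun2 _ _ _ mu _ _ (measurable_truncate n mu_) u2 _) => x.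
rewrite -[leLHS]real_normK ?num_real// -[leRHS]real_normK ?num_real//.
by rewrite lerXn2r ?nnegrE// truncate_le.
Qed.

Definition truncate2 (u : L2mu) n : L2mu := Lfun_Sub _ (truncate_Lfun2 u n).

Lemma norm_cvg_truncate u : norm_cvg ip (truncate2 u) u.
Proof.
apply: cvg0_sqr.
have [mu_ u2] := (Lfun2P mu u).1 (LfunP u).
have dom n x : `|(truncate u n x - u x) ^+ 2| <= u x ^+ 2.
  by rewrite ger0_norm ?sqr_ge0// /truncate; case: ifP => _; rewrite ?subrr ?expr0n ?sqr_ge0//= sub0r sqrrN.
have lim0 x : (truncate u n x - u x) ^+ 2 @[n --> \oo] --> (0 : R).
  have d0 : truncate u n x - u x @[n --> \oo] --> (0 : R) by apply/subr_cvg0; exact: cvg_truncate.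
  by rewrite -(mulr0 0); under eq_fun do rewrite expr2; exact: cvgM.
have mt n : measurable_fun (setT : set R)
    (fun x => (truncate u n x - u x) ^+ 2).
  by apply: measurable_funX; apply: measurable_funB => //; exact: measurable_truncate.
have := dominated_cvg_Rintegral mt (measurable_cst (0 : R)) u2 dom lim0.
rewrite /Rintegral integral0/=.
under eq_fun => n do rewrite -(nrm2_sqrE (truncate2 u n - u)).
exact.
Qed.

Lemma profile_cvg (u : L2mu) t :
  profile (truncate u n) t @[n --> \oo] --> profile u t.
Proof.
have mu_ := measurable_square_integrable u.
have iu : mu.-integrable setT (fun x => (`|u x|)%:E).
  by apply: integrable_norm; apply: Lfun2_integrable; exact: LfunP.
apply: (dominated_cvg_Rintegral _ _ iu).
- move=> n; apply: measurable_funM; first exact: measurable_truncate.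
  exact: measurable_centered_stepl.
- by apply: measurable_funM => //; exact: measurable_centered_stepl.
- move=> n x; rewrite normrM; apply: le_trans (truncate_le u n x).
  by rewrite ler_piMr// centered_step_le1.
- move=> x; apply: cvgM; [exact: cvg_truncate|exact: cvg_cst].
Qed.

Lemma truncate_energy (u : L2mu) n :
  (\int[leb]_t (profile (truncate u n) t ^+ 2)%:E)%E =
  (ip (K (truncate2 u n)) (truncate2 u n))%:E.
Proof.
have mt := measurable_truncate n (measurable_square_integrable u).
have tb := truncate_bounded u n; have tout := @truncate_out u n.
rewrite -EFin_Rintegral; last exact: (integrable_profile_sqr mt tb tout).
rewrite -(compact_support_energy mt tb tout); congr EFin.
by apply: eq_Rintegral => x _; rewrite mulrC.
Qed.

(** Equality holds for the truncations of u, to which the dominated convergence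
    theorem applies on the right and Fatou's lemma on the left. *)
Lemma energy_inequality (u : L2mu) :
  (\int[leb]_t (profile u t ^+ 2)%:E <= (ip (K u) u)%:E)%E.
Proof.
have HB := inner2_semi_inner mu.
pose F n t := (profile (truncate u n) t ^+ 2)%:E : \bar R.
have mF n : measurable_fun setT (F n).
  apply/measurable_EFinP; apply: measurable_funX; apply: measurable_profile.
  exact: measurable_truncate (measurable_square_integrable u).
have FE t : (profile u t ^+ 2)%:E = limn_einf (F^~ t).
  apply/esym; apply: (cvg_limn_einf_sup _).1; apply: cvg_EFin_seq.
  by rewrite expr2; under eq_fun do rewrite expr2; apply: cvgM; exact: profile_cvg.
under eq_integral do rewrite FE.
apply: le_trans (fatou _ _ _ _) _ => //.
  by move=> n t _; rewrite lee_fin sqr_ge0.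
have [C KC] := @kernel_operator_bounded _ _ _ mu h measurable_energy_kernel
  energy_section_Lfun2 h_sqr.
have := quadratic_form_cvg HB KC (norm_cvg_truncate u) => /cvg_EFin_seq.
under eq_fun do rewrite -truncate_energy.
by move=> /cvg_limn_einf_sup[-> _].
Qed.

Lemma energy_form_ge0 (u : L2mu) : 0 <= ip (K u) u.
Proof.
rewrite -lee_fin; apply: le_trans (energy_inequality u).
by apply: integral_ge0 => t _; rewrite lee_fin sqr_ge0.
Qed.

Local Notation apply_energy := (@apply_kernel _ _ _ mu h energy_section_Lfun2).

(** * The spectral theorem for the energy kernel *)

Definition one2 : L2mu := Lfun_Sub _ (Lfun_cst mu 1 2).

Lemma inner_one2 (u : L2mu) : ip u one2 = \int[mu]_x u x.
Proof. by apply: eq_Rintegral => x _ /=; rewrite mulr1. Qed.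

Lemma profileE (u : L2mu) t : ip u one2 = 0 ->
  profile u t = half_line_integral mu u t.
Proof.
move=> u0; have iu := Lfun2_integrable (LfunP u).
have mu_ := measurable_square_integrable u.
transitivity (\int[mu]_x (u x * step x t - mean_step t * u x)).
  by apply: eq_Rintegral => x _; rewrite /phi mulrBr [u x * mean_step t]mulrC.
rewrite RintegralB//; last 2 first.
- apply: le_integrable iu => //.
    by apply/measurable_EFinP; apply: measurable_funM => //; exact: measurable_stepl.
  move=> x _ /=; rewrite lee_fin normrM ler_piMr//.
  by rewrite ger0_norm ?step_ge0 ?step_le1.
- exact: (integrableZl measurableT (mean_step t) iu).
by rewrite RintegralZl// -inner_one2 u0 mulr0 subr0.
Qed.

(** The energy form vanishes on constants only, since the profile of u
    determines the integrals of u over all half-lines. *)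
Lemma energy_form_definite (u : L2mu) :
  ip (K u) u = 0 -> ip u one2 = 0 -> nrm ip u = 0.
Proof.
move=> Ku u1; have mu_ := measurable_square_integrable u.
have iu := Lfun2_integrable (LfunP u).
have mp := measurable_profile mu_.
have p0 : {ae leb, forall t, half_line_integral mu u t = 0}.
  have : ae_eq leb setT (fun t => (profile u t ^+ 2)%:E) (cst 0%E).
    apply/(ae_eq_integral_abs _ measurableT).
      by apply/measurable_EFinP; exact: measurable_funX.
    under eq_integral do rewrite gee0_abs ?lee_fin ?sqr_ge0//.
    apply/eqP; rewrite eq_le integral_ge0 ?andbT; last first.
      by move=> t _; rewrite lee_fin sqr_ge0.
    by have := energy_inequality u; rewrite Ku.
  apply: filterS => t /(_ I) [] /eqP; rewrite sqrf_eq0 => /eqP.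
  by rewrite profileE.
have := half_line_integral0_ae0 iu _ (half_line_integral_ae0 iu p0).
rewrite -inner_one2 => /(_ u1) u0.
have : (nrm ip u ^+ 2)%:E = 0%E.
  rewrite nrm2_sqrE -(integral0 mu setT).
  refine (@ae_eq_integral _ _ _ mu setT (cst 0%E) _ measurableT _ _ _) => //.
    by apply/measurable_EFinP; exact: measurable_funX.
  by apply: filterS u0 => x /(_ I) [ux] _ /=; rewrite ux expr0n.
by move=> [] /eqP; rewrite sqrf_eq0 => /eqP.
Qed.

(** The Lipschitz constant of h is inherited, as u is integrable. *)
Lemma apply_kernel_Lipschitz (u : L2mu) x x' :
  `|apply_energy u x - apply_energy u x'| <=
  `|x - x'| * \int[mu]_y `|u y|.
Proof.
have iu := Lfun2_integrable (LfunP u).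
have i1 z : mu.-integrable setT (fun y => (h z y * u y)%:E).
  by apply: Lfun2_integrableM; [exact: energy_section_Lfun2|exact: LfunP].
rewrite /apply_kernel /inner2 /inner -RintegralB//; [|exact: i1|exact: i1].
have ib := integrableB measurableT (i1 x) (i1 x').
apply: le_trans (le_normr_Rintegral _ ib) _ => //.
rewrite -RintegralZl//; last exact: integrable_norm.
apply: le_Rintegral => //; first exact: integrable_norm ib.
  exact: (integrableZl measurableT `|x - x'| (integrable_norm iu)).
move=> y _; rewrite -mulrBl normrM ler_wpM2r//; exact: energy_kernel_Lipschitz.
Qed.

Lemma continuous_apply_kernel (u : L2mu) :
  continuous (apply_energy u : R -> R).
Proof.
pose c : R := 1 + \int[mu]_y `|u y|.
have c0 : 0 < c by rewrite ltr_pwDl// Rintegral_ge0.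
move=> x; apply/cvgrPdist_le => eps eps0; near=> y.
apply: le_trans (apply_kernel_Lipschitz u x y) _.
have xy : `|x - y| <= eps / c.
  near: y; apply: (@cvgr_dist_le _ _ _ _ _ id x cvg_id).
  by rewrite divr_gt0.
apply: (@le_trans _ _ (eps / c * c)); last by rewrite divfK// gt_eqF.
apply: ler_pM => //; first by apply: Rintegral_ge0.
by rewrite /c lerDr.
Unshelve. all: by end_near. Qed.

Theorem energy_kernel_spectral_theorem :
  exists (m : option nat) (g : nat -> L2mu) (lam : nat -> R),
  [/\ forall i j, in_system m i -> in_system m j -> ip (g i) (g j) = (i == j)%:R,
      forall i, in_system m i ->
        [/\ forall x, apply_energy (g i) x = lam i * g i x,
            0 <= lam i, continuous (g i : R -> R)
          & lam i != 0 -> ip (g i) one2 = 0],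
      forall f : L2mu, exists a : nat -> R,
        (\int[mu]_x ((f x - \sum_(0 <= i < n | in_system m i) a i * g i x) ^+ 2)%:E)%E
          @[n --> \oo] --> 0%E
    & (\int[mu \x mu]_z ((h z.1 z.2 -
        \sum_(0 <= i < n | in_system m i) lam i * g i z.1 * g i z.2) ^+ 2)%:E)%E
          @[n --> \oo] --> 0%E].
Proof.
have one1 : ip one2 one2 = 1.
  by rewrite inner_one2/= Rintegral_prob_cst.
have Kone x : apply_energy one2 x = 0.
  rewrite /apply_kernel inner_one2; exact: integral_energy_kernel.
have [m [g [lam [gon geig gcomp gexp]]]] :=
  @kernel_spectral_theorem _ _ _ mu h measurable_energy_kernel energy_kernel_sym
  energy_section_Lfun2 h_sqr one2 one1 Kone energy_form_ge0 energy_form_definite.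
exists m, g, lam; split => // i im.
have [Kg gl] := geig i im; split => //.
- by case: gl => [[_ ->]|/ltW].
- case: gl => [[-> _]|l0]; first exact: cst_continuous.
  have -> : (g i : R -> R) = (fun x => (lam i)^-1 * apply_energy (g i) x).
    by apply/funext => x; rewrite Kg mulKf// gt_eqF.
  by move=> x; apply: cvgMl_tmp; exact: continuous_apply_kernel.
- move=> l0; apply: (mulfI l0); rewrite mulr0.
  have HB := inner2_semi_inner mu.
  rewrite -innerZl// (_ : lam i *: g i = K (g i)); last first.
    by apply/val_inj/funext => x /=; rewrite Kg.
  rewrite (@kernel_operator_sym _ _ _ mu h _ energy_kernel_sym).
  rewrite (_ : K one2 = 0) ?inner0r//.
  by apply/val_inj/funext => x /=; rewrite Kone.
Qed.

End CenteredSteps.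

(** * The kernel of independent copies *)

Section IndependentCopies.
Context d (T : measurableType d) (R : realType) (P : probability T R).
Variables Z Z1 Z2 : {RV P >-> R}.
Hypothesis copies : iid_copies Z Z1 Z2.
Local Notation leb := (@lebesgue_measure R).
Local Notation mu := (distribution P Z).
Local Notation phi := (centered_step mu).

Definition copies_pair (w : T) : R * R := (Z1 w, Z2 w).

Lemma measurable_copies_pair : measurable_fun setT copies_pair.
Proof. exact: measurable_fun_pair. Qed.

HB.instance Definition _ :=
  isMeasurableFun.Build _ _ _ _ copies_pair measurable_copies_pair.

Lemma copies_joint_law (A : set (R * R)) : measurable A ->
  (mu \x mu)%E A = pushforward P copies_pair A.
Proof.
have [Z1Z Z2Z ind] := copies.
apply: product_measure_unique => B C mB mC.
by rewrite [LHS]ind//; congr (_ * _)%E; [exact: Z1Z|exact: Z2Z].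
Qed.

Lemma ge0_integral_copies (F : R * R -> R) :
  measurable_fun setT F -> (forall z, 0 <= F z) ->
  (\int[P]_w (F (copies_pair w))%:E = \int[mu \x mu]_z (F z)%:E)%E.
Proof.
move=> mF F0; rewrite (eq_measure_integral (pushforward P copies_pair)); last first.
  by move=> A mA _; exact: copies_joint_law.
rewrite ge0_integral_pushforward//.
  exact/measurable_EFinP.
by move=> z _; rewrite lee_fin.
Qed.

Lemma integral_copies (F : R * R -> R) : measurable_fun setT F ->
  P.-integrable setT (fun w => (F (copies_pair w))%:E) ->
  (\int[P]_w (F (copies_pair w))%:E = \int[mu \x mu]_z (F z)%:E)%E.
Proof.
move=> mF iF; rewrite (eq_measure_integral (pushforward P copies_pair)); last first.
  by move=> A mA _; exact: copies_joint_law.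
rewrite integral_pushforward//.
exact/measurable_EFinP.
Qed.

Lemma Rintegral_copiesM (a b : R -> R) (C : R) :
  measurable_fun setT a -> measurable_fun setT b ->
  (forall x, `|a x| <= C) -> (forall x, `|b x| <= C) ->
  \int[P]_w (a (Z1 w) * b (Z2 w)) = (\int[mu]_x a x) * (\int[mu]_x b x).
Proof.
move=> ma mb aC bC.
have ia := @integrable_bounded _ _ _ mu a C ma aC.
have ib := @integrable_bounded _ _ _ mu b C mb bC.
have mab : measurable_fun setT (fun z : R * R => a z.1 * b z.2).
  by apply: measurable_funM; exact: measurableT_comp.
have iab : P.-integrable setT (fun w => (a (Z1 w) * b (Z2 w))%:E).
  apply: (@integrable_bounded _ _ _ P (fun w => a (Z1 w) * b (Z2 w)) (C * C)).
    by apply: measurable_funM; exact: measurableT_comp.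
  by move=> w; rewrite normrM ler_pM.
rewrite /Rintegral (integral_copies mab iab) -integral12_prod_meas1/=; last first.
  exact: integrable_tensor.
transitivity (fine (\int[mu]_x ((\int[mu]_y b y) * a x)%:E)%E); last first.
  by rewrite -/(Rintegral mu setT _) RintegralZl// mulrC.
congr fine; apply: eq_integral => x _; rewrite /fubini_F/=.
under eq_integral do rewrite EFinM.
by rewrite integralZl// -EFin_Rintegral// -EFinM mulrC.
Qed.

Local Notation defect := (kernel_integrand Z1 Z2).

Lemma measurable_kernel_integrand x y : measurable_fun setT (defect x y).
Proof.
apply: measurable_funD; last first.
  by apply: measurableT_comp => //; exact: measurable_funB.
apply: measurable_funB; first apply: measurable_funB => //.
  by apply: measurableT_comp => //; exact: measurable_funB.
by apply: measurableT_comp => //; exact: measurable_funB.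
Qed.

Lemma kernel_integrand_Lipschitz x y x' y' w :
  `|defect x y w - defect x' y' w| <= 2 * `|x - x'| + 2 * `|y - y'|.
Proof.
have A (a b c e : R) : `| `|a - b| - `|c - e| | <= `|a - c| + `|b - e|.
  apply: le_trans (ler_dist_dist _ _) _.
  rewrite (_ : a - b - (c - e) = (a - c) - (b - e)); last by ring.
  exact: ler_normB.
have := A x y x' y'; have := A x (Z2 w) x' (Z2 w); have := A (Z1 w) y (Z1 w) y'.
rewrite !subrr normr0 addr0 add0r /kernel_integrand => h1 h2 h3.
move: (`|x - y|) (`|x' - y'|) (`|x - Z2 w|) (`|x' - Z2 w|) (`|Z1 w - y|)
  (`|Z1 w - y'|) (`|Z1 w - Z2 w|) h1 h2 h3 => a a' b b' c c' e h1 h2 h3.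
rewrite (_ : a - b - c + e - (a' - b' - c' + e) = (a - a') - (b - b') - (c - c')); last by ring.
apply: le_trans (ler_normB _ _) _; apply: le_trans (lerD (ler_normB _ _) h1) _.
apply: le_trans (lerD (lerD h3 h2) (lexx _)) _.
by rewrite !mulr_natl !mulr2n addrACA addrA.
Qed.

Hypothesis exists_kernel : kernel_exists Z1 Z2.

(** Moving (x, y) changes the integrand by a bounded function. *)
Lemma integrable_kernel_integrand x y : P.-integrable setT (EFin \o defect x y).
Proof.
have [x' [y' i']] := exists_kernel.
have ic : P.-integrable setT (EFin \o cst (2 * `|x - x'| + 2 * `|y - y'|)).
  exact: finite_measure_integrable_cst.
have ia := integrableD measurableT (integrable_norm i') ic.
apply: le_integrable ia => //.
  by apply/measurable_EFinP; exact: measurable_kernel_integrand.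
move=> w _; rewrite lee_fin /=; apply: le_trans (ler_norm _).
have E : defect x y w = defect x' y' w + (defect x y w - defect x' y' w) by ring.
rewrite {1}E; apply: le_trans (ler_normD _ _) _; rewrite lerD2l.
exact: kernel_integrand_Lipschitz.
Qed.

Let S x y w t := step_diffM x (Z1 w) y (Z2 w) t.

Let integral_S x y w : \int[leb]_t S x y w t = - 2^-1 * defect x y w.
Proof. by have [_] := integral_step_diffM x (Z1 w) y (Z2 w). Qed.

Let measurable_S x y : measurable_fun setT (fun z : R * T => S x y z.2 z.1).
Proof.
have ms (a : R * T -> R) : measurable_fun setT a ->
    measurable_fun setT (fun z : R * T => step (a z) z.1).
  move=> ma; apply: (measurableT_comp (@measurable_step R) (g := fun z : R * T => (a z, z.1))).
  exact: measurable_fun_pair.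
apply: measurable_funM; apply: measurable_funB; apply: ms => //.
  exact: measurableT_comp.
exact: measurableT_comp.
Qed.

(** Two different centres are reduced to a single one, for which the product of
    step differences is nonnegative. *)
Let integrable_S x y : (leb \x P).-integrable setT (fun z : R * T => (S x y z.2 z.1)%:E).
Proof.
have mS : measurable_fun setT (fun z : R * T => (S x y z.2 z.1)%:E).
  by apply/measurable_EFinP; exact: measurable_S.
apply/integrable21ltyP => //.
have iG : P.-integrable setT (fun w => (`|x - y| + - 2^-1 * defect y y w)%:E).
  have ic : P.-integrable setT (EFin \o cst `|x - y|) by exact: finite_measure_integrable_cst.
  have := integrableD measurableT ic
    (integrableZl measurableT (- 2^-1) (integrable_kernel_integrand y y)).
  by apply: eq_integrable.
apply: le_lt_trans (integrable_lty measurableT iG).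
apply: ge0_le_integral => //.
- by move=> w _; exact: integral_ge0.
- have mabs := measurableT_comp (@abse_measurable R _) mS.
  exact: (@measurable_fun_fubini_tonelli_G _ _ _ _ _ leb _ mabs (fun z => abse_ge0 _)).
- by case/integrableP: iG.
move=> w _.
have [i1 e1] := integral_step_diffM x y x y.
have [i2 e2] := integral_step_diffM y (Z1 w) y (Z2 w).
have [i3 _] := integral_step_diffM x (Z1 w) y (Z2 w).
have -> : `|x - y| + - 2^-1 * defect y y w =
    \int[leb]_t (step_diffM x y x y t + step_diffM y (Z1 w) y (Z2 w) t).
  rewrite RintegralD// e1 e2 /kernel_integrand !subrr normr0 (distrC y x).
  by field.
have i12 := integrableD measurableT i1 i2.
rewrite EFin_Rintegral//; apply: le_integral => //; first exact: integrable_norm.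
by move=> t _; rewrite lee_fin; exact: step_diffM_le.
Qed.

Let mean_S x y t : \int[P]_w S x y w t = phi x t * phi y t.
Proof.
have ms (c : R) : measurable_fun setT (fun a : R => step c t - step a t).
  by apply: measurable_funB => //; exact: measurable_stepl.
rewrite (Rintegral_copiesM (ms x) (ms y)
  (step_diff_le1 x ^~ t) (step_diff_le1 y ^~ t)).
have E c : \int[mu]_a (step c t - step a t) = phi c t.
  rewrite RintegralB//; [|exact: finite_measure_integrable_cst|exact: integrable_stepl].
  by rewrite Rintegral_prob_cst.
by rewrite !E.
Qed.

Let integrable_S1 x y t : P.-integrable setT (EFin \o (S x y)^~ t).
Proof.
apply: (@integrable_bounded _ _ _ P _ 1).
  exact: (measurableT_comp (measurable_S x y) (measurable_pair1 t)).
move=> w; rewrite /S /step_diffM normrM -[1]mulr1.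
by apply: ler_pM; rewrite ?step_diff_le1.
Qed.

Lemma centered_step_sqr_integrable x :
  leb.-integrable setT (fun t => (phi x t ^+ 2)%:E).
Proof.
have := integrable_fubini_F (integrable_S x x); apply: eq_integrable => // t _.
rewrite /fubini_F/= -[LHS]EFin_Rintegral; last exact: integrable_S1.
by rewrite mean_S expr2.
Qed.

(** Both sides are integrals of the product of step differences over the sample
    space and the real line, taken in different orders. *)
Lemma h_kernelE x y : h_kernel Z1 Z2 x y = energy_kernel mu x y.
Proof.
transitivity (\int[P]_w \int[leb]_t S x y w t).
  under eq_Rintegral do rewrite integral_S.
  rewrite RintegralZl//; last exact: integrable_kernel_integrand.
  by rewrite /h_kernel unlock.
rewrite -(@Rintegral_Fubini _ _ _ _ _ leb P (fun t w => S x y w t)).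
- by apply: eq_Rintegral => t _; rewrite mean_S.
- by move=> t; exact: integrable_S1.
- by move=> w; have [] := integral_step_diffM x (Z1 w) y (Z2 w).
- exact: integrable_S.
Qed.

End IndependentCopies.

Lemma integrable_distribution_comp d (T : measurableType d) (R : realType)
    (P : probability T R) (Z : {RV P >-> R}) (u : R -> R) :
  (distribution P Z).-integrable setT (EFin \o u) ->
  P.-integrable setT (fun w => (u (Z w))%:E).
Proof.
move=> iu; have m_u : measurable_fun setT (EFin \o u) by exact: measurable_int iu.
apply/integrableP; split; first exact: (measurableT_comp (f := EFin \o u)).
move/integrableP: iu => [_]; rewrite ge0_integral_distribution//.
exact: measurableT_comp.
Qed.

Theorem theorem1 (d : measure_display) (T : measurableType d) (R : realType)
    (P : probability T R) (Z Z1 Z2 : {RV P >-> R}) (F : R -> R)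
    (HF : is_distribution_function Z F)
    (Hcopies : iid_copies Z Z1 Z2)
    (Hexists : kernel_exists Z1 Z2)
    (Hsquare : square_integrable_kernel (h_kernel Z1 Z2) Z1 Z2) :
  exists (m : option nat) (g : nat -> R -> R) (lam : nat -> R),
    [/\ orthonormal_system Z m g,
        complete_system Z m g,
        (forall k, in_system m k ->
           [/\ is_eigenfunction (h_kernel Z1 Z2) Z (lam k) (g k),
               0 <= lam k,
               continuous (g k)
             & lam k != 0 -> 'E_P[g k \o Z] = 0%E])
      & mean_square_cvg P
          (psum m (fun k w => lam k * g k (Z1 w) * g k (Z2 w)))
          (fun w => h_kernel Z1 Z2 (Z1 w) (Z2 w))].
Proof.
pose mu := distribution P Z.
have phi_sqr := centered_step_sqr_integrable Hcopies Hexists.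
have hE := h_kernelE Hcopies Hexists.
have mh := @measurable_energy_kernel R mu.
have mh2 : measurable_fun setT (fun z : R * R => energy_kernel mu z.1 z.2 ^+ 2).
  exact: measurable_funX.
have h_sqr : (mu \x mu).-integrable setT
    (fun z : R * R => (energy_kernel mu z.1 z.2 ^+ 2)%:E).
  apply/integrableP; split; first exact/measurable_EFinP.
  under eq_integral do rewrite gee0_abs ?lee_fin ?sqr_ge0//.
  rewrite -(ge0_integral_copies Hcopies mh2); last by move=> z; exact: sqr_ge0.
  move: Hsquare; rewrite /square_integrable_kernel unlock.
  by under eq_integral do rewrite hE.
have [m [g [lam [gon geig gcomp gexp]]]] := energy_kernel_spectral_theorem phi_sqr h_sqr.
have E2 (u v : R -> R) : u \in Lfun mu 2%:E -> v \in Lfun mu 2%:E ->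
    'E_P[fun w => u (Z w) * v (Z w)] = (inner mu u v)%:E.
  move=> u2 v2; have iuv := Lfun2_integrableM u2 v2.
  rewrite unlock /inner EFin_Rintegral// integral_distribution//.
    exact: measurable_int iuv.
  exact: (@integrable_distribution_comp _ _ _ P Z (fun x => u x * v x)).
exists m, (fun k => g k : R -> R), lam; split.
- split=> [k _|k l km lm]; first exact: LfunP.
  by rewrite E2 ?LfunP// -(gon _ _ km lm).
- move=> f f2; have [a ca] := gcomp (Lfun_Sub _ f2).
  exists a; rewrite /mean_square_cvg unlock.
  have [mf _] := (Lfun2P mu f).1 f2.
  apply: cvg_trans ca; apply: near_eq_cvg; apply: nearW => n.
  rewrite (@ge0_integral_distribution _ _ _ _ _ P Z
    (fun x => ((f x - \sum_(0 <= i < n | in_system m i) a i * g i x) ^+ 2)%:E))//.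
    apply/measurable_EFinP; apply: measurable_funX; apply: measurable_funB => //.
    under eq_fun do rewrite -big_filter.
    apply: measurable_sum => i; apply: measurable_funM; first exact: measurable_cst.
    exact: (measurable_square_integrable (g i)).
  by move=> x; rewrite lee_fin sqr_ge0.
- move=> k km; have [Kg l0 gc gmean] := geig k km; split => //.
  + split; first by under eq_fun do rewrite expr2; rewrite E2 ?LfunP// -/(inner2 _ _) gon// eqxx.
    move=> z; under eq_fun do rewrite hE.
    rewrite E2 ?LfunP//; last exact: energy_section_Lfun2.
    by rewrite -Kg.
  + move=> /gmean g1; rewrite -[RHS](congr1 EFin g1) /inner2 -E2 ?LfunP//.
    by congr expectation; apply/funext => w /=; rewrite mulr1.
- rewrite /mean_square_cvg unlock.
  apply: cvg_trans gexp; apply: near_eq_cvg; apply: nearW => n.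
  rewrite -(ge0_integral_copies Hcopies).
  - by apply: eq_integral => w _; rewrite hE.
  - apply: measurable_funX; apply: measurable_funB => //.
    under eq_fun do rewrite -big_filter.
    apply: measurable_sum => i; apply: measurable_funM.
      by apply: measurable_funM => //; apply: measurableT_comp => //; exact: measurable_square_integrable.
    by apply: measurableT_comp => //; exact: measurable_square_integrable.
  - by move=> z; exact: sqr_ge0.
Qed.
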